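(* Let $\Phi$ satisfy Assumption $(\Phi)$ and let $\rho(t)=t^{-1}/\Phi^{-1}(t^{-1})$, $t\in(0,\infty)$. Then $(T^\infty_{\Phi,\mathrm v}(\mathcal X))^*$, the dual space of $T^\infty_{\Phi,\mathrm v}(\mathcal X)$, coincides with $\widetilde T_\Phi(\mathcal X)$ in the following sense: For any $g\in\widetilde T_\Phi(\mathcal X)$, define the linear functional $\ell$ by setting, for all $f\in T^\infty_{\Phi,\mathrm v}(\mathcal X)$, $$\ell(f)=\int_{\mathcal X\times(0,\infty)}f(x,t)g(x,t)\,\frac{d\mu(x)\,dt}{t}.\qquad( * )$$ Then there exists a positive constant $C$, independent of $g$, such that $\|\ell\|_{(T^\infty_{\Phi,\mathrm v}(\mathcal X))^*}\le C\|g\|_{\widetilde T_\Phi(\mathcal X)}$. Conversely, for any $\ell\in(T^\infty_{\Phi,\mathrm v}(\mathcal X))^*$, there exists $g\in\widetilde T_\Phi(\mathcal X)$ such that $( * )$ holds for all $f\in T^\infty_{\Phi,\mathrm v}(\mathcal X)$ and $\|g\|_{\widetilde T_\Phi(\mathcal X)}\le C\|\ell\|_{(T^\infty_{\Phi,\mathrm v}(\mathcal X))^*}$, where $C$ is a positive constant independent of $\ell$.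
   Context: **Space.** $(\mathcal X,d)$ is a metric space with a nonnegative Borel regular measure $\mu$ which is doubling: with $B(x,r)=\{y:d(x,y)<r\}$ and $V(x,r)=\mu(B(x,r))$, there is $C_1\ge 1$ with $V(x,2r)\le C_1V(x,r)<\infty$ for all $x\in\mathcal X$, $r>0$. $r_B$ is the radius of a ball $B$; $E^\complement$ is the complement of $E$; $x_0\in\mathcal X$ is a fixed point. **Orlicz function.** Assumption $(\Phi)$: $\Phi$ is a positive, continuous, strictly increasing, concave function on $(0,\infty)$ with critical lower type $p_\Phi^-\in(0,1]$, where $p_\Phi^-$ is the supremum of $p\in(0,\infty)$ for which there is $C$ with $\Phi(st)\le Ct^p\Phi(s)$ for all $t\in(0,1)$, $s>0$. **Tent spaces.** For open $O$, $\widehat O=\{(x,t)\in\mathcal X\times(0,\infty):d(x,O^\complement)\ge t\}$. For measurable $g$ on $\mathcal X\times(0,\infty)$ let $Q(g,B)=\frac1{\rho(\mu(B))}\big[\frac1{\mu(B)}\iint_{\widehat B}|g(y,t)|^2\frac{d\mu(y)dt}{t}\big]^{1/2}$. $T^\infty_\Phi(\mathcal X)$ is the space of $g$ with $\|g\|_{T^\infty_\Phi(\mathcal X)}=\|\mathcal C_\rho(g)\|_{L^\infty(\mathcal X)}<\infty$, $\mathcal C_\rho(g)(x)=\sup_{B\ni x}Q(g,B)$. $T^\infty_{\Phi,\mathrm v}(\mathcal X)$ is the space of $g\in T^\infty_\Phi(\mathcal X)$ with $\lim_{c\to0}\sup_{r_B\le c}Q(g,B)=\lim_{c\to\infty}\sup_{r_B\ge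 c}Q(g,B)=\lim_{c\to\infty}\sup_{B\subset[B(x_0,c)]^\complement}Q(g,B)=0$, with the norm of $T^\infty_\Phi(\mathcal X)$. **Atoms and $\widetilde T_\Phi$.** A function $a$ on $\mathcal X\times(0,\infty)$ is a $T_\Phi(\mathcal X)$-atom if for some ball $B$, $\mathrm{supp}\,a\subset\widehat B$ and $\iint_{\widehat B}|a(x,t)|^2\frac{d\mu(x)dt}{t}\le[\mu(B)]^{-1}[\rho(\mu(B))]^{-2}$. An atom is regarded as an element of $(T^\infty_\Phi(\mathcal X))^*$ via $h\mapsto\int ah\,\frac{d\mu\,dt}{t}$. $\widetilde T_\Phi(\mathcal X)$ is the space of all $f=\sum_{j=1}^\infty\lambda_ja_j$ in $(T^\infty_\Phi(\mathcal X))^*$ with $a_j$ $T_\Phi(\mathcal X)$-atoms, $\lambda_j\in\mathbb C$, $\sum_j|\lambda_j|<\infty$; $\|f\|_{\widetilde T_\Phi(\mathcal X)}=\inf\sum_j|\lambda_j|$ over all such decompositions. For $g=\sum_j\lambda_ja_j\in\widetilde T_\Phi(\mathcal X)$ and $f\in T^\infty_\Phi(\mathcal X)$, $\int fg\,\frac{d\mu\,dt}{t}$ is the value $\sum_j\lambda_j\int fa_j\,\frac{d\mu\,dt}{t}$ of the functional $g$ at $f$. *)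

(* Defs.v *)
From HB Require Import structures.
From mathcomp Require Import all_boot all_order all_algebra.
From mathcomp Require Import all_classical all_reals all_analysis.
From mathcomp Require Import complex.

Set Implicit Arguments.
Unset Strict Implicit.
Unset Printing Implicit Defensive.

Import Order.TTheory GRing.Theory Num.Theory.
Import numFieldNormedType.Exports.
Import ComplexField.Normc.

Local Open Scope classical_set_scope.
Local Open Scope ring_scope.

(* A metric space that also carries a sigma-algebra; the compatibility of the
   two structures is the hypothesis [borel_regular] below. *)
#[short(type="measurableMetricType")]
HB.structure Definition MeasurableMetric (d : measure_display)
  (R : realType) := {X of Measurable d X & Metric R X}.

Section OrliczFunction.
Context {R : realType}.
Implicit Type Phi : R -> R.

Definition lower_type Phi (p : R) : Prop :=
  exists C : R, forall t s : R, 0 < t -> t < 1 -> 0 < s ->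
    Phi (s * t) <= C * t `^ p * Phi s.

Definition critical_lower_type Phi : \bar R :=
  ereal_sup [set p%:E | p in [set p : R | 0 < p /\ lower_type Phi p]].

(* Only the values on (0, oo) matter. *)
Record orlicz_assumption Phi : Prop := {
  orlicz_gt0 : forall t : R, 0 < t -> 0 < Phi t;
  orlicz_continuous : {within `]0, +oo[, continuous Phi};
  orlicz_increasing : forall s t : R, 0 < s -> s < t -> Phi s < Phi t;
  orlicz_concave : forall s t u : R, 0 < s -> 0 < t -> 0 <= u <= 1 ->
    u * Phi s + (1 - u) * Phi t <= Phi (u * s + (1 - u) * t);
  orlicz_critical_type : (0 < critical_lower_type Phi <= 1)%E
}.

(* Under [orlicz_assumption], Phi maps (0, oo) bijectively onto itself. *)
Definition Phi_inv Phi : R -> R := 'pinv_(fun=> 0) `]0, +oo[ Phi.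

Definition rho Phi (t : R) : R := t^-1 / Phi_inv Phi t^-1.

End OrliczFunction.

(* Duals of a space S of complex-valued functions with a (semi)norm N. A
   functional is a function on all of T -> R[i] of which only the restriction
   to S is meaningful; since it is bounded for N, it does not distinguish
   functions at N-distance 0, so S need not be quotiented. *)
Section Dual.
Context {R : realType} {T : Type}.
Implicit Types (S : set (T -> R[i])) (N : (T -> R[i]) -> \bar R)
  (l : (T -> R[i]) -> R[i]).

Definition linear_on S l : Prop :=
  forall (c : R[i]) f h, S f -> S h ->
    l (fun z => c * f z + h z) = c * l f + l h.

Definition dual_norm S N l : \bar R :=
  ereal_sup [set (normc (l f))%:E | f in [set f | S f /\ (N f <= 1)%E]].

Definition in_dual S N l : Prop :=
  linear_on S l /\ (dual_norm S N l < +oo)%E.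

End Dual.

Section TentSpaces.
Context {d : measure_display} {R : realType} {X : measurableMetricType d R}.
Variable mu : {measure set X -> \bar R}.

Definition doubling : Prop :=
  exists2 C1 : R, 1 <= C1 &
    forall (x : X) (r : R), 0 < r ->
      (mu (ball x (2 * r)) <= C1%:E * mu (ball x r) < +oo)%E.

Definition borel_regular : Prop :=
  (forall O : set X, open O -> measurable O) /\
  (forall A : set X, measurable A -> exists B : set X,
    [/\ <<s [set O : set X | open O] >> B, A `<=` B & mu B = mu A]).

(* Functions on X x (0, oo) are functions on X x R considered on [upper]. *)
Local Notation XR := (X * measurableTypeR R)%type.
Implicit Types (f g h a : XR -> R[i]) (x y : X) (r c : R).

Definition upper : set XR := [set: X] `*` `]0, +oo[.

(* d(x, A), with value +oo when A is empty *)
Definition dist_set (A : set X) x : \bar R :=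
  ereal_inf [set (mdist x y)%:E | y in A].

Definition tent (O : set X) : set XR :=
  [set z | upper z /\ (z.2%:E <= dist_set (~` O) z.1)%E].

Definition cmeasurable g : Prop :=
  measurable_fun upper (fun z => complex.Re (g z)) /\
  measurable_fun upper (fun z => complex.Im (g z)).

(* iint_D |g|^2 dmu dt / t *)
Definition sqint (D : set XR) g : \bar R :=
  (\int[mu \x @lebesgue_measure R]_(z in D) (normc (g z) ^+ 2 / z.2)%:E)%E.

(* int f a dmu dt / t over X x (0, oo), by real and imaginary parts *)
Definition pairing f a : R[i] :=
  Complex
    (\int[(mu \x @lebesgue_measure R)%E]_(z in upper)
        (complex.Re (f z * a z) / z.2))
    (\int[(mu \x @lebesgue_measure R)%E]_(z in upper)
        (complex.Im (f z * a z) / z.2)).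

Definition V x r : R := fine (mu (ball x r)).

Section Phi.
Variable Phi : R -> R.

(* Q(g, B) for the ball B = B(x, r) *)
Definition Q g x r : \bar R :=
  ((rho Phi (V x r))^-1%:E *
     ((V x r)^-1%:E * sqint (tent (ball x r)) g) `^ 2^-1)%E.

(* Supremum in [0, +oo] (so that the empty supremum is 0) of Q(g, B) over the
   balls B = B(x, r) such that P x r. *)
Definition supQ g (P : X -> R -> Prop) : \bar R :=
  ereal_sup (0%E |` [set q | exists x r, [/\ 0 < r, P x r & q = Q g x r]]).

Definition C_rho g y : \bar R := supQ g (fun x r => ball x r y).

Definition Tinf_norm g : \bar R := 'N[mu]_+oo%E[C_rho g]%E.

Definition Tinf : set (XR -> R[i]) :=
  [set g | cmeasurable g /\ (Tinf_norm g < +oo)%E].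

Definition Tinf_v (x0 : X) : set (XR -> R[i]) :=
  [set g | [/\ Tinf g,
    supQ g (fun _ r => r <= c) @[c --> 0^'+] --> 0%E,
    supQ g (fun _ r => c <= r) @[c --> +oo] --> 0%E &
    supQ g (fun x r => ball x r `<=` ~` ball x0 c) @[c --> +oo] --> 0%E]].

(* [tent (ball x r)] is closed in X x (0, oo), so it contains the support of a
   as soon as it contains the points where a is nonzero. *)
Definition atom a : Prop :=
  cmeasurable a /\
  exists x r, [/\ 0 < r,
    [set z | upper z /\ a z != 0] `<=` tent (ball x r) &
    (sqint (tent (ball x r)) a
      <= ((V x r)^-1 * (rho Phi (V x r)) ^- 2)%:E)%E].

(* g = sum_j lam_j a_j, convergent in the dual of Tinf, with sum_j |lam_j|
   finite *)
Definition atomic_decomposition (g : (XR -> R[i]) -> R[i])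
    (lam : nat -> R[i]) (a : nat -> XR -> R[i]) : Prop :=
  [/\ forall j, atom (a j),
      (\sum_(0 <= j <oo) (normc (lam j))%:E < +oo)%E &
      dual_norm Tinf Tinf_norm
        (fun f => g f - \sum_(j < n) lam j * pairing f (a j))
        @[n --> \oo] --> 0%E].

Definition Ttilde : set ((XR -> R[i]) -> R[i]) :=
  [set g | in_dual Tinf Tinf_norm g /\
    exists lam (aj : nat -> XR -> R[i]), atomic_decomposition g lam aj].

Definition Ttilde_norm (g : (XR -> R[i]) -> R[i]) : \bar R :=
  ereal_inf [set s | exists lam (aj : nat -> XR -> R[i]),
    atomic_decomposition g lam aj /\
    s = (\sum_(0 <= j <oo) (normc (lam j))%:E)%E].

End Phi.

End TentSpaces.

(* Main.v *)
(** With w_B = 1 / (rho(mu B) sqrt(mu B)), Q(f, B) is w_B times the norm of f in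
    L^2(tent B, dmu dt / t), and an atom on B is a function supported in the tent
    whose L^2 norm is at most w_B.  Cauchy-Schwarz thus bounds the pairing of f
    with an atom by the norm of f, which gives the first half.

    For the converse, the doubling property and the positive lower type of Phi
    provide countably many balls B_j such that the norm of f is comparable to
    sup_j Q(f, B_j), while only finitely many of them have radius in a compact
    subset of (0, oo) and centre in a bounded set.  The three vanishing
    conditions then say that w_j ||f||_{L^2(tent B_j)} tends to 0, so the
    vanishing tent space embeds into a c_0-sum of Hilbert spaces.  By
    Hahn-Banach and the Riesz theorem a bounded functional has the form
    f |-> sum_j w_j <f, h_j> with sum_j ||h_j|| finite, and this is an atomic
    series with coefficients ||h_j|| and atoms w_j h_j / ||h_j||. *)
Require Import Defs.
From HB Require Import structures.
From mathcomp Require Import all_boot all_order all_algebra.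
From mathcomp Require Import all_classical all_reals all_analysis.
From mathcomp Require Import complex.
From mathcomp Require Import measurable_realfun ess_sup_inf ring lra.

Set Implicit Arguments.
Unset Strict Implicit.
Unset Printing Implicit Defensive.

Import Order.TTheory GRing.Theory Num.Theory.
Import numFieldNormedType.Exports.

Local Open Scope classical_set_scope.
Local Open Scope ring_scope.

(** * Hahn-Banach *)

Section HahnBanach.
Context {R : realType} {V : lmodType R}.
Implicit Types (E : set V) (p q L : V -> R) (G : set (V * R)).

(** Hahn-Banach and Riesz are used in real form. Only [Re (l f)] is extended, each ball contributes
    two real coordinates, the real and the imaginary part of f, and complex linearity recovers
    [Im (l f)] from the value at i f. Functions are never identified almost everywhere, so the norms
    are only seminorms and distinct functions may share their coordinates; the functional to be
    extended is therefore given by its graph. The extension lives on all bounded sequences, where it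
    need not be a series; it is one on sequences tending to 0 because truncations converge to them
    in the supremum norm, and this is what the vanishing conditions provide. Replacing an arbitrary
    ball by a ball of a countable family rests on 1 / rho at the smaller measure being at most a
    constant times its value at a comparable larger one, a consequence of the positive lower type of
    Phi. As mu may vanish identically, the family of balls is allowed to be empty. *)

Definition subspace E : Prop :=
  E 0 /\ forall (c : R) u v, E u -> E v -> E (c *: u + v).

Definition sublinear_on E q : Prop :=
  (forall (c : R) u, 0 <= c -> E u -> q (c *: u) = c * q u) /\
  (forall u v, E u -> E v -> q (u + v) <= q u + q v).

Lemma subspaceZ E c u : subspace E -> E u -> E (c *: u).
Proof. by move=> [E0 EE] Eu; rewrite -[c *: u]addr0; exact: EE. Qed.

Lemma subspaceD E u v : subspace E -> E u -> E v -> E (u + v).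
Proof. by move=> [E0 EE] Eu Ev; rewrite -[u]scale1r; exact: EE. Qed.

Lemma subspaceN E u : subspace E -> E u -> E (- u).
Proof. by move=> sE Eu; rewrite -scaleN1r; exact: subspaceZ. Qed.

Lemma sublinear_on0 E q : subspace E -> sublinear_on E q -> q 0 = 0.
Proof. by move=> [E0 _] [qZ _]; rewrite -(scale0r 0) qZ// mul0r. Qed.

Lemma sublinear_on_ge E q u : subspace E -> sublinear_on E q -> E u ->
  - q (- u) <= q u.
Proof.
move=> sE sq Eu; rewrite -subr_ge0 opprK -(sublinear_on0 sE sq) -(subrr u).
by case: sq => _; apply => //; exact: subspaceN.
Qed.

(** For fixed v, the functional x |-> inf over t >= 0 of q (x + t v) - t q v is sublinear and below
    q. Minimality puts q below it, and t = 1 gives q u + q v <= q (u + v), so q is additive. *)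
Lemma minimal_sublinear_linear E q : subspace E -> sublinear_on E q ->
  (forall q', sublinear_on E q' -> (forall u, E u -> q' u <= q u) ->
    forall u, E u -> q u <= q' u) ->
  forall (c : R) u v, E u -> E v -> q (c *: u + v) = c * q u + q v.
Proof.
move=> sE sq qmin.
have [qZ qD] := sq.
have q0 := sublinear_on0 sE sq.
have qDE u v : E u -> E v -> q (u + v) = q u + q v.
  move=> Eu Ev.
  pose Y x := [set q (x + t *: v) - t * q v | t in [set t : R | 0 <= t]].
  have Y0 x : Y x !=set0 by exists (q (x + 0 *: v) - 0 * q v), 0 => /=.
  have Ylb x : E x -> lbound (Y x) (- q (- x)).
    (* Subadditivity for t v = (x + t v) + (- x) bounds the family below, uniformly in t. *)
    move=> Ex _ [t /= t0 <-].
    have Etv : E (x + t *: v) by apply: subspaceD => //; exact: subspaceZ.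
    have := qD _ _ Etv (subspaceN sE Ex); rewrite addrAC subrr add0r qZ//; lra.
  pose q' x := inf (Y x).
  have q'le x t : E x -> 0 <= t -> q' x <= q (x + t *: v) - t * q v.
    by move=> Ex t0; apply: ge_inf; [exists (- q (- x)); exact: Ylb|exists t].
  have q'ge x y : (forall t, 0 <= t -> y <= q (x + t *: v) - t * q v) ->
      y <= q' x.
    by move=> h; apply: lb_le_inf => // _ [t t0 <-]; exact: h.
  have q'Zle c x : 0 < c -> E x -> q' (c *: x) <= c * q' x.
    move=> c0 Ex; rewrite -ler_pdivrMl//; apply: q'ge => t t0.
    rewrite ler_pdivrMl//; apply: le_trans (q'le _ (c * t) _ _) _.
    - exact: subspaceZ.
    - by rewrite mulr_ge0// ltW.
    - rewrite -scalerA -scalerDr qZ ?(ltW c0)//; first by rewrite mulrBr mulrA.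
      by apply: subspaceD => //; exact: subspaceZ.
  have q'_le x : E x -> q' x <= q x.
    by move=> Ex; have := q'le x 0 Ex (lexx _); rewrite scale0r addr0 mul0r subr0.
  have sq' : sublinear_on E q'.
    split=> [c x|x y Ex Ey].
      rewrite le_eqVlt => /predU1P[<- Ex|c0 Ex].
        rewrite scale0r mul0r; apply/le_anti; rewrite -{1}q0 q'_le/=; last first.
          by case: sE.
        by apply: q'ge => t t0; rewrite add0r qZ// subrr.
      apply/le_anti; rewrite q'Zle//= -ler_pdivlMl//.
      rewrite -[in leLHS](scalerK (lt0r_neq0 c0) x) q'Zle ?invr_gt0//.
      exact: subspaceZ.
    rewrite -lerBlDl; apply: (q'ge) => t t0; rewrite lerBlDl -lerBlDr.
    apply: q'ge => s s0; rewrite lerBlDr.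
    apply: le_trans (q'le _ (s + t) _ _) _.
    - exact: subspaceD.
    - exact: addr_ge0.
    - rewrite scalerDl addrACA mulrDl.
      have := qD (x + s *: v) (y + t *: v).
      have Exs : E (x + s *: v) by apply: subspaceD => //; exact: subspaceZ.
      have Eyt : E (y + t *: v) by apply: subspaceD => //; exact: subspaceZ.
      by move=> /(_ Exs Eyt); lra.
  apply/le_anti; rewrite qD//=.
  have := le_trans (qmin _ sq' q'_le _ Eu) (q'le u 1 Eu ler01).
  by rewrite scale1r mul1r lerBrDr.
have qN u : E u -> q (- u) = - q u.
  move=> Eu; apply/eqP; rewrite -subr_eq0 opprK -qDE//; last exact: subspaceN.
  by rewrite addrC subrr q0.
move=> c u v Eu Ev; rewrite qDE//; last exact: subspaceZ.
congr +%R; have [c0|c0] := leP 0 c; first by rewrite qZ.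
rewrite -[c]opprK scaleNr qN; last exact: subspaceZ.
by rewrite qZ// ?mulNr// oppr_ge0 ltW.
Qed.

(** Zorn's lemma yields a minimal sublinear functional below p, which is linear. The comparison
    ignores values off [E], hence is only a preorder. A chain is bounded by its pointwise infimum,
    which is finite because every member is at least - p (- u) at u. *)
Lemma sublinear_dominates_linear E p : subspace E -> sublinear_on E p ->
  exists2 L, (forall (c : R) u v, E u -> E v -> L (c *: u + v) = c * L u + L v)
    & forall u, E u -> L u <= p u.
Proof.
move=> sE sp.
pose T := {q : V -> R | sublinear_on E q /\ forall u, E u -> q u <= p u}.
pose p0 : T := exist _ p (conj sp (fun u _ => lexx (p u))).
pose rel (s t : T) : bool := `[< forall u, E u -> sval t u <= sval s u >].
have [q qmax] : exists q : T, premaximal rel q.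
  apply: (@ZL_preorder T p0 rel).
  - by move=> t; apply/asboolP.
  - move=> r s t /asboolP rs /asboolP st; apply/asboolP => u Eu.
    exact: le_trans (st _ Eu) (rs _ Eu).
  - move=> A Atot.
    have [[s0 As0]|A0] := pselect (A !=set0); last first.
      by exists p0 => s As; exfalso; apply: A0; exists s.
    pose Y u := [set sval s u | s in A].
    have Y0 u : Y u !=set0 by exists (sval s0 u), s0.
    have Ylb u : E u -> lbound (Y u) (- p (- u)).
      move=> Eu _ [s As <-]; have [ss sp'] := svalP s.
      apply: le_trans (sublinear_on_ge sE ss Eu).
      by rewrite lerN2; apply: sp'; exact: subspaceN.
    pose m u := inf (Y u).
    have mle u s : E u -> A s -> m u <= sval s u.
      by move=> Eu As; apply: ge_inf; [exists (- p (- u)); exact: Ylb|exists s].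
    have mge u y : (forall s, A s -> y <= sval s u) -> y <= m u.
      by move=> h; apply: lb_le_inf => // _ [s As <-]; exact: h.
    have mZle c u : 0 < c -> E u -> m (c *: u) <= c * m u.
      move=> c0 Eu; rewrite -ler_pdivrMl//; apply: mge => s As.
      rewrite ler_pdivrMl//; apply: le_trans (mle _ s _ As) _.
        exact: subspaceZ.
      by have [[sZ _] _] := svalP s; rewrite sZ// ltW.
    have sm : sublinear_on E m.
      split=> [c u|u v Eu Ev].
        rewrite le_eqVlt => /predU1P[<- Eu|c0 Eu].
          rewrite scale0r mul0r; apply/le_anti.
          have s00 (s : T) : sval s 0 = 0.
            by have [ss _] := svalP s; exact: (sublinear_on0 sE ss).
          rewrite -{1}(s00 s0) mle//=; last by case: sE.
          by apply: mge => s _; rewrite s00.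
        apply/le_anti; rewrite mZle//= -ler_pdivlMl//.
        rewrite -[in leLHS](scalerK (lt0r_neq0 c0) u) mZle ?invr_gt0//.
        exact: subspaceZ.
      rewrite -lerBlDl; apply: (mge) => s As; rewrite lerBlDl -lerBlDr.
      apply: mge => t At; rewrite lerBlDr.
      have Euv : E (u + v) by exact: subspaceD.
      (* Two members of the chain are comparable, and the smaller one serves for both summands. *)
      have [/asboolP st|/asboolP ts] := Atot _ _ As At.
        apply: le_trans (mle _ t Euv At) _.
        have [[_ tD] _] := svalP t; apply: le_trans (tD _ _ Eu Ev) _.
        by rewrite lerD2l st.
      apply: le_trans (mle _ s Euv As) _.
      have [[_ sD] _] := svalP s; apply: le_trans (sD _ _ Eu Ev) _.
      by rewrite lerD2r ts.
    have mp u : E u -> m u <= p u.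
      move=> Eu; apply: le_trans (mle u s0 Eu As0) _.
      by have [_] := svalP s0; apply.
    exists (exist _ m (conj sm mp)) => s As; apply/asboolP => u Eu /=.
    exact: mle.
have [sq qp] := svalP q.
exists (sval q) => //; apply: minimal_sublinear_linear => // q' sq' q'q u Eu.
have q'p v : E v -> q' v <= p v.
  by move=> Ev; apply: le_trans (q'q v Ev) (qp v Ev).
have := qmax (exist _ q' (conj sq' q'p)).
have -> : rel q (exist _ q' (conj sq' q'p)) by apply/asboolP.
by move=> /(_ isT)/asboolP; apply.
Qed.

(* [q] is the largest sublinear functional below [p] that is dominated by the
   prescribed values on the graph [G]. *)
Theorem hahn_banach E p G : subspace E -> sublinear_on E p ->
  G (0, 0) ->
  (forall (c : R) u v, G u -> G v -> G (c *: u.1 + v.1, c * u.2 + v.2)) ->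
  (forall u, G u -> E u.1 /\ u.2 <= p u.1) ->
  exists L, [/\
    forall (c : R) u v, E u -> E v -> L (c *: u + v) = c * L u + L v,
    forall u, E u -> L u <= p u &
    forall u, G u -> L u.1 = u.2].
Proof.
move=> sE sp G0 GG Gp; have [pZ pD] := sp.
have GN u : G u -> G (- u.1, - u.2).
  by move=> Gu; have := GG (-1) u _ Gu G0; rewrite /= scaleN1r mulN1r !addr0.
pose Y x := [set p (x - g.1) + g.2 | g in G].
have Y0 x : Y x !=set0 by exists (p (x - 0) + 0), (0, 0).
have Ylb x : E x -> lbound (Y x) (- p (- x)).
  move=> Ex _ [g Gg <-]; have [Eg gp] := Gp _ Gg.
  have [EgN gpN] := Gp _ (GN _ Gg).
  have := pD (x - g.1) (- x).
  have Exg : E (x - g.1) by apply: subspaceD => //; exact: subspaceN.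
  have ENx : E (- x) by exact: subspaceN.
  move=> /(_ Exg ENx); rewrite addrAC subrr add0r.
  by move: gpN => /=; lra.
pose q x := inf (Y x).
have qle x g : E x -> G g -> q x <= p (x - g.1) + g.2.
  by move=> Ex Gg; apply: ge_inf; [exists (- p (- x)); exact: Ylb|exists g].
have qge x y : (forall g, G g -> y <= p (x - g.1) + g.2) -> y <= q x.
  by move=> h; apply: lb_le_inf => // _ [t t0 <-]; exact: h.
have qZle c x : 0 < c -> E x -> q (c *: x) <= c * q x.
  move=> c0 Ex; rewrite -ler_pdivrMl//; apply: qge => g Gg.
  have Gcg := GG c _ _ Gg G0; rewrite /= !addr0 in Gcg.
  have Ecx : E (c *: x) by exact: subspaceZ.
  rewrite ler_pdivrMl//; apply: le_trans (qle _ _ Ecx Gcg) _.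
  rewrite /= -scalerBr pZ ?(ltW c0)//; first by rewrite mulrDr.
  by apply: subspaceD => //; apply: subspaceN => //; case: (Gp _ Gg).
have q_le x : E x -> q x <= p x.
  by move=> Ex; have := qle x _ Ex G0; rewrite /= subr0 addr0.
have sq : sublinear_on E q.
  split=> [c x|x y Ex Ey].
    rewrite le_eqVlt => /predU1P[<- Ex|c0 Ex].
      rewrite scale0r mul0r; apply/le_anti.
      rewrite -{1}(sublinear_on0 sE sp) q_le/=; last by case: sE.
      apply: qge => g /GN Gg; have [_] := Gp _ Gg; rewrite sub0r/=; lra.
    apply/le_anti; rewrite qZle//= -ler_pdivlMl//.
    rewrite -[in leLHS](scalerK (lt0r_neq0 c0) x) qZle ?invr_gt0//.
    exact: subspaceZ.
  rewrite -lerBlDl; apply: (qge) => g Gg; rewrite lerBlDl -lerBlDr.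
  apply: qge => h Gh; rewrite lerBlDr.
  have Gs := GG 1 _ _ Gg Gh; rewrite /= scale1r mul1r in Gs.
  have Exy : E (x + y) by exact: subspaceD.
  apply: le_trans (qle _ _ Exy Gs) _ => /=.
  have [Eg _] := Gp _ Gg; have [Eh _] := Gp _ Gh.
  have -> : x + y - (g.1 + h.1) = (x - h.1) + (y - g.1).
    by rewrite [RHS]addrACA -opprD (addrC h.1).
  have := pD (x - h.1) (y - g.1).
  have E1 : E (x - h.1) by apply: subspaceD => //; exact: subspaceN.
  have E2 : E (y - g.1) by apply: subspaceD => //; exact: subspaceN.
  by move=> /(_ E1 E2); lra.
have [L Llin Lq] := sublinear_dominates_linear sE sq.
exists L; split=> // [u Eu|]; first by apply: le_trans (Lq u Eu) (q_le u Eu).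
(* Choosing g itself in the infimum gives one inequality; [G] is stable under negation, which gives
   the other. *)
have LG g : G g -> L g.1 <= g.2.
  move=> Gg; have [Eg _] := Gp _ Gg.
  apply: le_trans (Lq _ Eg) _; apply: le_trans (qle _ _ Eg Gg) _.
  by rewrite subrr (sublinear_on0 sE sp) add0r.
move=> g Gg; apply/le_anti; rewrite LG//=.
have [Eg _] := Gp _ Gg; have E0 : E 0 by case: sE.
have L0 : L 0 = 0.
  by have := Llin 1 0 0 E0 E0; rewrite scaler0 addr0 mul1r => /eqP; rewrite -subr_eq0 opprD addNKr oppr_eq0 => /eqP.
have := LG _ (GN _ Gg); have := Llin (-1) _ _ Eg E0.
by rewrite scaleN1r addr0 L0 /= => ->; lra.
Qed.

End HahnBanach.

(** * Real L^2 spaces *)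

Section L2.
Context d (T : measurableType d) (R : realType).
Variable m : {measure set T -> \bar R}.
Implicit Types (u v w : T -> R) (c e : R).

Definition L2 u : Prop :=
  measurable_fun setT u /\ (\int[m]_x (u x ^+ 2)%:E < +oo)%E.

Definition inner u v : R := \int[m]_x (u x * v x).

Definition nrm u : R := Num.sqrt (inner u u).

Lemma le_integral_sq (u : T -> R) (v : T -> \bar R) :
  measurable_fun setT u -> measurable_fun setT v ->
  (forall x, ((u x ^+ 2)%:E <= v x)%E) -> (\int[m]_x v x < +oo)%E -> L2 u.
Proof.
move=> mu mv uv vy; split=> //; apply: le_lt_trans vy.
apply: ge0_le_integral => //.
- by move=> x _; rewrite lee_fin sqr_ge0.
- by apply/measurable_EFinP; exact: measurable_funX.
Qed.

Lemma L2_0 : L2 (fun=> 0).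
Proof.
split; first exact: measurable_cst.
by under eq_integral do rewrite expr0n/=; rewrite integral0.
Qed.

Lemma measurable_sqE u : measurable_fun setT u ->
  measurable_fun setT (fun x => (u x ^+ 2)%:E).
Proof. by move=> mu; apply/measurable_EFinP; exact: measurable_funX. Qed.

Lemma integral_sq_comb_lty c e u v : L2 u -> L2 v ->
  (\int[m]_x (c%:E * (u x ^+ 2)%:E + e%:E * (v x ^+ 2)%:E) < +oo)%E.
Proof.
move=> [mu iu] [mv iv].
have iE w : measurable_fun setT w -> (\int[m]_x (w x ^+ 2)%:E < +oo)%E ->
    m.-integrable setT (fun x => (w x ^+ 2)%:E).
  move=> mw iw; apply/integrableP; split; first exact: measurable_sqE.
  by under eq_integral do rewrite gee0_abs ?lee_fin ?sqr_ge0//.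
rewrite integralD//=; last 2 first.
- by apply: integrableZl => //; exact: iE.
- by apply: integrableZl => //; exact: iE.
rewrite !integralZl//; [|exact: iE|exact: iE].
by rewrite lte_add_pinfty// ltey_eq fin_numM// ge0_fin_numE//;
  apply: integral_ge0 => x _; rewrite lee_fin sqr_ge0.
Qed.

Lemma L2_lin c u v : L2 u -> L2 v -> L2 (fun x => c * u x + v x).
Proof.
move=> Lu Lv; have [mu iu] := Lu; have [mv iv] := Lv.
apply: (@le_integral_sq _ (fun x =>
  (2 * c ^+ 2)%:E * (u x ^+ 2)%:E + 2%:E * (v x ^+ 2)%:E)%E).
- by apply: measurable_funD => //; exact: measurable_funM.
- by apply: emeasurable_funD; apply: measurable_funeM; exact: measurable_sqE.
- move=> x; rewrite -!EFinM -EFinD lee_fin.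
  by have := sqr_ge0 (c * u x - v x); nra.
- exact: integral_sq_comb_lty.
Qed.

Lemma L2Z c u : L2 u -> L2 (fun x => c * u x).
Proof.
move=> Lu; have := L2_lin c Lu L2_0.
by under [X in L2 X]eq_fun do rewrite addr0.
Qed.

Lemma L2B u v : L2 u -> L2 v -> L2 (fun x => u x - v x).
Proof.
move=> Lu Lv; have := L2_lin (-1) Lv Lu.
by under [X in L2 X]eq_fun do rewrite mulN1r addrC.
Qed.

Lemma integrable_mulL2 u v : L2 u -> L2 v ->
  m.-integrable setT (EFin \o (fun x => u x * v x)).
Proof.
move=> Lu Lv; have [mu iu] := Lu; have [mv iv] := Lv.
apply/integrableP; split.
  by apply/measurable_EFinP; exact: measurable_funM.
apply: le_lt_trans (integral_sq_comb_lty 1 1 Lu Lv).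
apply: ge0_le_integral => //.
- by apply/measurable_EFinP/measurableT_comp => //; exact: measurable_funM.
- by apply: emeasurable_funD; apply: measurable_funeM; exact: measurable_sqE.
- move=> x _; rewrite -!EFinM -EFinD /= lee_fin normrM !mul1r.
  rewrite -(real_normK (num_real (u x))) -(real_normK (num_real (v x))).
  by have := sqr_ge0 (`|u x| - `|v x|); have := normr_ge0 (u x);
    have := normr_ge0 (v x); nra.
Qed.

Lemma innerC u v : inner u v = inner v u.
Proof. by rewrite /inner; congr fine; apply: eq_integral => x _; rewrite mulrC. Qed.

Lemma inner_linl c u v w : L2 u -> L2 v -> L2 w ->
  inner (fun x => c * u x + v x) w = c * inner u w + inner v w.
Proof.
move=> Lu Lv Lw; rewrite /inner.
under eq_Rintegral do rewrite mulrDl -mulrA.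
have iuw := integrable_mulL2 Lu Lw.
rewrite RintegralD//; last 2 first.
- by apply: (@eq_integrable _ _ _ _ setT _
    (fun x => c%:E * ((u x * w x)%:E))%E) => //; exact: integrableZl.
- exact: integrable_mulL2.
by rewrite RintegralZl.
Qed.

Lemma inner0l w : inner (fun=> 0) w = 0.
Proof. by rewrite /inner; under eq_Rintegral do rewrite mul0r; rewrite Rintegral_cst// mul0r. Qed.

Lemma innerZl c u w : L2 u -> L2 w ->
  inner (fun x => c * u x) w = c * inner u w.
Proof.
move=> Lu Lw; have := inner_linl c Lu L2_0 Lw.
by rewrite inner0l addr0 => <-; congr inner; apply/funext => x; rewrite addr0.
Qed.

Lemma inner_linr c u v w : L2 u -> L2 v -> L2 w ->
  inner w (fun x => c * u x + v x) = c * inner w u + inner w v.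
Proof. by move=> ? ? ?; rewrite innerC inner_linl// !(innerC w). Qed.

Lemma innerZr c u w : L2 u -> L2 w ->
  inner w (fun x => c * u x) = c * inner w u.
Proof. by move=> ? ?; rewrite innerC innerZl// (innerC w). Qed.

Lemma inner_ge0 u : 0 <= inner u u.
Proof. by apply: Rintegral_ge0 => x _; rewrite -expr2 sqr_ge0. Qed.

Lemma nrm_ge0 u : 0 <= nrm u. Proof. exact: sqrtr_ge0. Qed.

Lemma sqr_nrm u : nrm u ^+ 2 = inner u u.
Proof. by rewrite sqr_sqrtr// inner_ge0. Qed.

Lemma nrm0 : nrm (fun=> 0) = 0.
Proof. by rewrite /nrm inner0l sqrtr0. Qed.

Lemma integral_sqE u : L2 u -> (\int[m]_x (u x ^+ 2)%:E)%E = (nrm u ^+ 2)%:E.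
Proof.
move=> [mu iu]; rewrite sqr_nrm /inner /Rintegral fineK.
  by apply: eq_integral => x _; rewrite expr2.
under eq_integral do rewrite -expr2.
by rewrite ge0_fin_numE//; apply: integral_ge0 => x _; rewrite lee_fin sqr_ge0.
Qed.

Lemma sqr_nrm_lin c u v : L2 u -> L2 v ->
  nrm (fun x => c * u x + v x) ^+ 2 =
  c ^+ 2 * nrm u ^+ 2 + 2 * c * inner u v + nrm v ^+ 2.
Proof.
move=> Lu Lv; rewrite !sqr_nrm; have Luv := L2_lin c Lu Lv.
rewrite inner_linl// !inner_linr// (innerC v u); ring.
Qed.

(** Expand |c u + v|^2 >= 0 with c = - |v| / |u|. A vanishing seminorm does not make the function
    zero, so the null cases are separate: if |u| = 0 the square is affine in c, and were [inner u v]
    positive, the chosen c would make it equal to -1. *)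
Lemma inner_le u v : L2 u -> L2 v -> inner u v <= nrm u * nrm v.
Proof.
move=> Lu Lv; have [u0|u0] := eqVneq (nrm u) 0.
  rewrite u0 mul0r leNgt; apply/negP => i0.
  have := sqr_ge0 (nrm (fun x => - (nrm v ^+ 2 + 1) / (2 * inner u v) * u x + v x)).
  rewrite sqr_nrm_lin// u0 expr0n/= mulr0 add0r.
  have -> : 2 * (- (nrm v ^+ 2 + 1) / (2 * inner u v)) * inner u v = - (nrm v ^+ 2 + 1).
    by field; rewrite gt_eqF.
  lra.
have [v0|v0] := eqVneq (nrm v) 0.
  rewrite v0 mulr0 leNgt; apply/negP => i0.
  have := sqr_ge0 (nrm (fun x => - (nrm u ^+ 2 + 1) / (2 * inner u v) * v x + u x)).
  rewrite sqr_nrm_lin// v0 expr0n/= mulr0 add0r (innerC v u).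
  have -> : 2 * (- (nrm u ^+ 2 + 1) / (2 * inner u v)) * inner u v = - (nrm u ^+ 2 + 1).
    by field; rewrite gt_eqF.
  lra.
have nu : 0 < nrm u by rewrite lt_neqAle eq_sym u0 nrm_ge0.
have nv : 0 < nrm v by rewrite lt_neqAle eq_sym v0 nrm_ge0.
have := sqr_ge0 (nrm (fun x => - (nrm v / nrm u) * u x + v x)).
rewrite sqr_nrm_lin//.
have -> : (- (nrm v / nrm u)) ^+ 2 * nrm u ^+ 2 + 2 * - (nrm v / nrm u) * inner u v +
   nrm v ^+ 2 = 2 * (nrm v / nrm u) * (nrm u * nrm v - inner u v).
  by field.
by rewrite pmulr_rge0 ?subr_ge0// mulr_gt0// divr_gt0.
Qed.

Lemma nrmZ c u : L2 u -> nrm (fun x => c * u x) = `|c| * nrm u.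
Proof.
move=> Lu; rewrite /nrm innerZl ?innerZr//; last exact: L2Z.
by rewrite mulrA -expr2 sqrtrM ?sqr_ge0// sqrtr_sqr.
Qed.

Lemma nrmN u : L2 u -> nrm (fun x => - u x) = nrm u.
Proof.
move=> Lu; have := nrmZ (-1) Lu; rewrite normrN1 mul1r => <-.
by congr nrm; apply/funext => x; rewrite mulN1r.
Qed.

Lemma normr_inner_le u v : L2 u -> L2 v -> `|inner u v| <= nrm u * nrm v.
Proof.
move=> Lu Lv; rewrite ler_norml inner_le// andbT lerNl.
have LN := L2Z (-1) Lu.
by have := inner_le LN Lv; rewrite innerZl// nrmZ// normrN1 mul1r mulN1r.
Qed.

Lemma nrm_lin_le c u v : L2 u -> L2 v ->
  nrm (fun x => c * u x + v x) <= `|c| * nrm u + nrm v.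
Proof.
move=> Lu Lv; rewrite -(@ler_pXn2r _ 2) ?nnegrE ?nrm_ge0//; last first.
  by rewrite addr_ge0 ?mulr_ge0 ?nrm_ge0.
rewrite sqr_nrm_lin// sqrrD exprMn real_normK ?num_real// lerD2r lerD2l.
have h : c * inner u v <= `|c| * (nrm u * nrm v).
  by apply: le_trans (ler_norm _) _; rewrite normrM ler_wpM2l// normr_inner_le.
by rewrite mulr2n; lra.
Qed.

Lemma nrmD_le u v : L2 u -> L2 v -> nrm (fun x => u x + v x) <= nrm u + nrm v.
Proof.
move=> Lu Lv; have := nrm_lin_le 1 Lu Lv; rewrite normr1 mul1r.
by under [X in nrm X]eq_fun do rewrite mul1r.
Qed.

Lemma nrmB_le u v w : L2 u -> L2 v -> L2 w ->
  nrm (fun x => u x - w x) <= nrm (fun x => u x - v x) + nrm (fun x => v x - w x).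
Proof.
move=> Lu Lv Lw; have := nrmD_le (L2B Lu Lv) (L2B Lv Lw).
by under [X in nrm X <= _]eq_fun do rewrite addrA subrK.
Qed.

End L2.

(** * Completeness of L^2 and the Riesz representation theorem *)

Lemma limn_einf_le_bound (R : realType) (v : (\bar R)^nat) (c : \bar R) (N : nat) :
  (forall k, (N <= k)%N -> (v k <= c)%E) -> (limn_einf v <= c)%E.
Proof.
move=> vc; rewrite limn_einf_lim; apply: lime_le; first exact: is_cvg_einfs.
apply: nearW => n; apply: ge_ereal_inf; exists (v (maxn n N)).
  by exists (maxn n N) => //=; exact: leq_maxl.
by apply: vc; exact: leq_maxr.
Qed.

Lemma limn_einf_ge0 (R : realType) (v : (\bar R)^nat) :
  (forall k, (0 <= v k)%E) -> (0 <= limn_einf v)%E.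
Proof.
move=> v0; rewrite limn_einf_lim; apply: lime_ge; first exact: is_cvg_einfs.
by apply: nearW => n; apply: le_ereal_inf_tmp => _ [k _ <-].
Qed.

Lemma half_expr_lt (R : realType) (y : R) : 0 < y -> exists n, 2^-1 ^+ n < y.
Proof.
move=> y0; exists (Num.truncn y^-1).+1; rewrite exprVn invf_plt ?posrE ?exprn_gt0//.
have := @truncnS_gt R y^-1 => /lt_le_trans; apply.
by rewrite -natrX ler_nat ltnW// ltn_expl.
Qed.

Lemma sum_half_expr_le (R : realType) n : \sum_(k < n) 2^-1 ^+ k <= 2 :> R.
Proof.
suff : \sum_(k < n) 2^-1 ^+ k = 2 - 2 * 2^-1 ^+ n :> R.
  by move=> ->; rewrite gerBl mulr_ge0// exprn_ge0// invr_ge0.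
elim: n => [|n IH]; first by rewrite big_ord0 expr0; ring.
by rewrite big_ord_recr/= IH exprS; field.
Qed.

Section L2_Riesz.
Context d (T : measurableType d) (R : realType).
Variable m : {measure set T -> \bar R}.
Implicit Types (u v w : T -> R) (c e : R).
Local Notation L2 := (L2 m).
Local Notation nrm := (nrm m).
Local Notation inner := (inner m).

Lemma nrmBC u v : L2 u -> L2 v ->
  nrm (fun x => u x - v x) = nrm (fun x => v x - u x).
Proof.
move=> Lu Lv; rewrite -(nrmN (L2B Lu Lv)).
by congr nrm; apply/funext => x; rewrite opprB.
Qed.

(** The bound is the exact geometric sum of 2^-i for n <= i < n + k; keeping the subtracted term
    lets the induction close. *)
Lemma nrm_fast_cauchy (u_ : nat -> T -> R) : (forall n, L2 (u_ n)) ->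
  (forall n, nrm (fun x => u_ n.+1 x - u_ n x) <= 2^-1 ^+ n) ->
  forall n k, nrm (fun x => u_ n x - u_ (n + k)%N x) <=
    2 * 2^-1 ^+ n - 2 * 2^-1 ^+ (n + k).
Proof.
move=> Lu_ cu_ n; elim=> [|k IH].
  rewrite addn0 subrr; under [X in nrm X]eq_fun do rewrite subrr.
  by rewrite nrm0.
apply: le_trans (nrmB_le (Lu_ n) (Lu_ (n + k)%N) (Lu_ _)) _.
rewrite addnS (nrmBC (Lu_ (n + k)%N) (Lu_ _)) exprS.
by have := cu_ (n + k)%N; move: IH; set q := _ ^+ (n + k); lra.
Qed.

(* By AM-GM the summability of [2^n |u_(n+1) - u_n|^2] forces that of
   [|u_(n+1) - u_n|]. *)
Lemma cvg_sum_sq (a : R^nat) :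
  (\sum_(n <oo) (2 ^+ n * (a n.+1 - a n) ^+ 2)%:E < +oo)%E -> cvgn a.
Proof.
set S := (\sum_(_ <oo) _)%E => Sy.
have S0 : (0 <= S)%E.
  by apply: nneseries_ge0 => n _ _; rewrite lee_fin mulr_ge0 ?sqr_ge0 ?exprn_ge0.
have Sfin : S \is a fin_num by rewrite ge0_fin_numE.
have partial n : \sum_(k < n) 2 ^+ k * (a k.+1 - a k) ^+ 2 <= fine S.
  rewrite -lee_fin fineK// -sumEFin -(big_mkord xpredT
    (fun k => (2 ^+ k * (a k.+1 - a k) ^+ 2)%:E)).
  by apply: nneseries_lim_ge => k _ _; rewrite lee_fin mulr_ge0 ?sqr_ge0 ?exprn_ge0.
have cvd : cvgn (series (fun n => a n.+1 - a n)).
  apply: normed_cvg; apply: nondecreasing_is_cvgn.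
    by apply: nondecreasing_series => // n _ _; exact: normr_ge0.
  exists (fine S + 2) => _ [n _ <-]; rewrite /= /series/= big_mkord.
  apply: le_trans (lerD (partial n) (sum_half_expr_le R n)).
  rewrite -big_split/=; apply: ler_sum => k _.
  set t := a k.+1 - a k; rewrite -(real_normK (num_real t)).
  have p0 : 0 < 2 ^+ k :> R by rewrite exprn_gt0.
  rewrite exprVn; set p := 2 ^+ k in p0 *.
  have -> : p * `|t| ^+ 2 + p^-1 = p^-1 * ((p * `|t| - 1) ^+ 2 + 2 * p * `|t|).
    by field; rewrite gt_eqF.
  rewrite mulrDr -[leLHS]add0r lerD//.
    by rewrite mulr_ge0 ?sqr_ge0// invr_ge0 ltW.
  have -> : p^-1 * (2 * p * `|t|) = 2 * `|t| by field; rewrite gt_eqF.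
  have := normr_ge0 t; lra.
have -> : a = (fun n => a 0%N + series (fun n => a n.+1 - a n) n).
  apply/funext => n; rewrite /series/= telescope_sumr//; ring.
by apply: is_cvgD => //; exact: is_cvg_cst.
Qed.

(** The integrals of 2^n |u_(n+1) - u_n|^2 sum to at most the sum of 2^-n, that is 2; hence the
    series of these functions is finite almost everywhere and the sequence converges there. Fatou's
    lemma carries the geometric bound over to the limit. *)
Lemma L2_complete (u_ : nat -> T -> R) : (forall n, L2 (u_ n)) ->
  (forall n, nrm (fun x => u_ n.+1 x - u_ n x) <= 2^-1 ^+ n) ->
  exists2 u, L2 u & forall n, nrm (fun x => u_ n x - u x) <= 2 * 2^-1 ^+ n.
Proof.
move=> Lu_ cu_.
have mu_ n : measurable_fun setT (u_ n) by case: (Lu_ n).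
(* The upper limit is measurable and defined everywhere, and it agrees with the limit wherever the
   sequence converges. *)
pose u x : R := fine (limn_esup (fun n => (u_ n x)%:E)).
have mu : measurable_fun setT u.
  apply: measurableT_comp; first exact: fine_measurable.
  by apply: measurable_fun_limn_esup => n; apply/measurable_EFinP.
pose s n x := (2 ^+ n * (u_ n.+1 x - u_ n x) ^+ 2)%:E.
have s0 n x : (0 <= s n x)%E by rewrite lee_fin mulr_ge0 ?sqr_ge0 ?exprn_ge0.
have ms n : measurable_fun setT (s n).
  apply/measurable_EFinP; apply: measurable_funM => //.
  by apply: measurable_funX; exact: measurable_funB.
have iS : (\int[m]_x (\sum_(n <oo) s n x) < +oo)%E.
  rewrite integral_nneseries//.
  have /le_lt_trans : (\sum_(n <oo) \int[m]_x s n x <= 2%:E)%E.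
    apply: le_trans (epsilon_trick0 xpredT (ler0n R 2)).
    apply: lee_nneseries => [n _ _|n _]; first exact: integral_ge0.
    under eq_integral do rewrite /s EFinM.
    rewrite ge0_integralZl//; last 2 first.
    - by apply: measurable_sqE; exact: measurable_funB.
    - by move=> x _; rewrite lee_fin sqr_ge0.
    rewrite integral_sqE; last exact: L2B.
    have -> : 2 / (2 ^ n.+1)%:R = (2 ^+ n)^-1 :> R.
      by rewrite natrX exprS; field; rewrite expf_neq0.
    rewrite -EFinM lee_fin.
    have : nrm (fun x => u_ n.+1 x - u_ n x) ^+ 2 <= (2^-1 ^+ n) ^+ 2.
      by rewrite ler_pXn2r ?nnegrE ?nrm_ge0 ?exprn_ge0 ?invr_ge0.
    have p0 : 0 < 2 ^+ n :> R by rewrite exprn_gt0.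
    move=> h; apply: le_trans (ler_wpM2l (ltW p0) h) _.
    by rewrite exprVn expr2 mulrA mulfV ?gt_eqF// mul1r.
  by apply; rewrite ltry.
have aecvg : {ae m, forall x, cvgn (fun n => u_ n x)}.
  have : m.-integrable setT (fun x => \sum_(n <oo) s n x)%E.
    apply/integrableP; split.
      by apply: ge0_emeasurable_sum => // n x _ _; exact: s0.
    by under eq_integral do rewrite gee0_abs ?nneseries_ge0//.
  move=> /integrable_ae => /(_ measurableT); apply: filterS => x /(_ I) Sx.
  by apply: cvg_sum_sq; rewrite -ge0_fin_numE ?nneseries_ge0// => n _ _; exact: s0.
have bound n : (\int[m]_x ((u_ n x - u x) ^+ 2)%:E <= ((2 * 2^-1 ^+ n) ^+ 2)%:E)%E.
  pose g k x := ((u_ n x - u_ k x) ^+ 2)%:E.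
  have mg k : measurable_fun setT (g k).
    by apply: measurable_sqE; exact: measurable_funB.
  have g0 k x : (0 <= g k x)%E by rewrite lee_fin sqr_ge0.
  apply: (@le_trans _ _ (\int[m]_x limn_einf (g ^~ x))%E).
    apply: ae_ge0_le_integral => //.
    - by move=> x _; rewrite lee_fin sqr_ge0.
    - by apply: measurable_sqE; exact: measurable_funB.
    - by move=> x _; exact: limn_einf_ge0.
    - apply: measurableT_comp => //; apply: measurable_fun_limn_esup => k.
      exact: measurableT_comp.
    apply: filterS aecvg => x cx _.
    have ux : (fun k => u_ k x) @ \oo --> u x.
      have e : ((fun k => (u_ k x)%:E) @ \oo --> (limn (u_ ^~ x))%:E)%E.
        by apply: cvg_EFin => //; exact: nearW.
      by rewrite /u (cvg_limn_einf_sup e).2.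
    have gx : (g ^~ x @ \oo --> ((u_ n x - u x) ^+ 2)%:E)%E.
      apply: cvg_EFin; first exact: nearW.
      rewrite /comp/=; under eq_cvg do rewrite expr2.
      by rewrite expr2; apply: cvgM; apply: cvgB => //; exact: cvg_cst.
    by rewrite (cvg_limn_einf_sup gx).1.
  apply: le_trans (fatou _ _ _ _) _ => //.
  apply: (@limn_einf_le_bound _ _ _ n) => k nk.
  rewrite integral_sqE; last exact: L2B.
  rewrite lee_fin ler_pXn2r ?nnegrE ?nrm_ge0 ?mulr_ge0 ?exprn_ge0 ?invr_ge0//.
  have := nrm_fast_cauchy Lu_ cu_ n (k - n); rewrite subnKC// => /le_trans; apply.
  by rewrite gerBl mulr_ge0// exprn_ge0// invr_ge0.
have Lub n : L2 (fun x => u_ n x - u x).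
  split; first exact: measurable_funB.
  by apply: le_lt_trans (bound n) _; rewrite ltry.
exists u.
  have := L2B (Lu_ 0%N) (Lub 0%N).
  by under [X in L2 X -> _]eq_fun do rewrite subKr.
by move=> n; have := bound n;
  rewrite integral_sqE// lee_fin ler_pXn2r ?nnegrE ?nrm_ge0 ?mulr_ge0.
Qed.

(** The representative minimises J u = |u|^2 - 2 phi u. A minimising sequence is Cauchy by the
    parallelogram law, and if [phi v] differed from [inner v h], a step along v from a late term
    would push J below its infimum. *)
Theorem L2_riesz (phi : (T -> R) -> R) (M : R) :
  (forall c u v, L2 u -> L2 v ->
    phi (fun x => c * u x + v x) = c * phi u + phi v) ->
  (forall u, L2 u -> `|phi u| <= M * nrm u) ->
  exists2 h, L2 h & forall u, L2 u -> phi u = inner u h.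
Proof.
move=> phiL phiM.
pose J u := nrm u ^+ 2 - 2 * phi u.
pose Y := [set J u | u in [set u | L2 u]].
have Ylb : lbound Y (- M ^+ 2).
  move=> _ [u Lu <-]; rewrite /J.
  have := ler_norm (phi u); have := phiM u Lu; have := sqr_ge0 (nrm u - M); nra.
have Yinf : has_inf Y.
  by split; [exists (J (fun=> 0)), (fun=> 0) => //; exact: L2_0|exists (- M ^+ 2)].
pose m0 := inf Y.
have m0le u : L2 u -> m0 <= J u.
  by move=> Lu; apply: ge_inf; [exists (- M ^+ 2)|exists u].
(* At the midpoint, J is the mean of the two values minus |u - v|^2 / 4. Excesses below e n thus
   give |u_(n+1) - u_n|^2 <= 4 e n = (2^-n)^2. *)
pose e n : R := (2^-1 ^+ n) ^+ 2 / 4.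
have e0 n : 0 < e n by rewrite divr_gt0// exprn_gt0// exprn_gt0// invr_gt0.
have /choice[u_ u_P] : forall n, exists u, L2 u /\ J u < m0 + e n.
  by move=> n; have [_ [u Lu <-] ult] := inf_adherent (e0 n) Yinf; exists u.
have Lu_ n : L2 (u_ n) by have [] := u_P n.
have Ju_ n : J (u_ n) < m0 + e n by have [] := u_P n.
have phiZ c u : L2 u -> phi (fun x => c * u x) = c * phi u.
  move=> Lu; have L0 := L2_0 m.
  have : phi (fun=> 0) = 0.
    by have := phiL 1 _ _ L0 L0; rewrite mulr0 addr0 mul1r; lra.
  have := phiL c _ _ Lu L0.
  by under [X in phi X]eq_fun do rewrite addr0; move=> -> ->; rewrite addr0.
have [h Lh uh] : exists2 h, L2 h &
    forall n, nrm (fun x => u_ n x - h x) <= 2 * 2^-1 ^+ n.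
  apply: L2_complete => // n.
  rewrite -(@ler_pXn2r _ 2) ?nnegrE ?nrm_ge0 ?exprn_ge0 ?invr_ge0//.
  have e1 : e n.+1 <= e n.
    rewrite /e ler_pM2r// ler_pXn2r ?nnegrE ?exprn_ge0 ?invr_ge0//.
    by rewrite exprS ger_pMl ?exprn_gt0 ?invr_gt0//; lra.
  have e2 : e n * 4 = (2^-1 ^+ n) ^+ 2 by rewrite /e divfK.
  have Lw := L2Z (2^-1) (Lu_ n).
  have := m0le _ (L2_lin 2^-1 (Lu_ n.+1) Lw).
  have := sqr_nrm_lin (-1) (Lu_ n) (Lu_ n.+1).
  have -> : (fun x => -1 * u_ n x + u_ n.+1 x) = (fun x => u_ n.+1 x - u_ n x).
    by apply/funext => x; rewrite mulN1r addrC.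
  rewrite /J sqr_nrm_lin// phiL// phiZ// innerZr// nrmZ//.
  rewrite ger0_norm ?invr_ge0// exprMn (innerC _ (u_ n)).
  have := Ju_ n; have := Ju_ n.+1; rewrite /J -e2; lra.
exists h => // v Lv; have [//|hv0] := eqVneq (phi v) (inner v h); exfalso.
rewrite -subr_eq0 in hv0.
set del := phi v - inner v h in hv0.
(* Nearly the optimal step length del / |v|^2; the added 1 covers |v| = 0. *)
pose t := del / (nrm v ^+ 2 + 1).
have nv1 : 0 < nrm v ^+ 2 + 1 by rewrite ltr_wpDl ?sqr_ge0.
have Xn : 0 < 2 * t * del - t ^+ 2 * nrm v ^+ 2.
  rewrite [ltRHS](_ : _ = del ^+ 2 / (nrm v ^+ 2 + 1) *
      (1 + (nrm v ^+ 2 + 1)^-1)).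
    rewrite mulr_gt0 ?divr_gt0 ?exprn_even_gt0// ltr_wpDr// invr_ge0 ltW//.
  by rewrite /t; field; rewrite gt_eqF.
set X := (ltRHS) in Xn.
(* K 2^-n dominates the excess e n plus the error 2 |t| |v| |u_n - h| made by stepping from u_n
   instead of h; n is then taken so large that the gain X exceeds it. *)
pose K := 1 + 4 * `|t| * nrm v.
have K0 : 0 < K by rewrite ltr_wpDr// ?mulr_ge0// nrm_ge0.
have [n nX] := half_expr_lt (divr_gt0 Xn K0).
rewrite ltr_pdivlMr// in nX.
have en : e n <= 2^-1 ^+ n.
  rewrite /e; have : 2^-1 ^+ n <= 1 :> R by rewrite exprn_ile1// ?invr_ge0//; lra.
  have : 0 <= 2^-1 ^+ n :> R by rewrite exprn_ge0// invr_ge0.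
  nra.
have := m0le _ (L2_lin t Lv (Lu_ n)).
have := Ju_ n.
rewrite /J sqr_nrm_lin// phiL//.
have : t * (inner v (u_ n) - inner v h) <= `|t| * (nrm v * (2 * 2^-1 ^+ n)).
  have -> : inner v (u_ n) - inner v h = inner v (fun x => -1 * h x + u_ n x).
    by rewrite inner_linr// mulN1r addrC.
  apply: le_trans (ler_norm _) _; rewrite normrM ler_wpM2l//.
  apply: le_trans (normr_inner_le Lv (L2_lin (-1) Lh (Lu_ n))) _.
  rewrite ler_wpM2l ?nrm_ge0//; apply: le_trans (uh n).
  by rewrite (_ : (fun x => -1 * h x + u_ n x) = fun x => u_ n x - h x)//;
    apply/funext => x; rewrite mulN1r addrC.
move: nX en; rewrite /X /K /del; nra.
Qed.

End L2_Riesz.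

(** * The dual of a c_0-sum of L^2 spaces *)

Section L2_sequences.
Context d (T : measurableType d) (R : realType).
Variable m : {measure set T -> \bar R}.
Local Notation L2 := (L2 m).
Local Notation nrm := (nrm m).
Local Notation inner := (inner m).
Local Notation V := (nat -> T -> R^o).
Implicit Types (F : V) (u v : T -> R).

(** This l^infinity-sum is the ambient space of the extension; the representing sequence is read off
    from sequences with a single nonzero entry. *)
Definition bounded_L2 : set V :=
  [set F | (forall j, L2 (F j)) /\ exists K, forall j, nrm (F j) <= K].

Definition sup_nrm F : R := sup [set nrm (F j) | j in setT].

Definition delta (j : nat) u : V := fun i => if i == j then u else fun=> 0.

Definition trunc (n : nat) F : V := fun i => if (i < n)%N then F i else fun=> 0.

Lemma nrm_le_sup F j : bounded_L2 F -> nrm (F j) <= sup_nrm F.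
Proof.
by move=> [_ [K FK]]; apply: ub_le_sup; [exists K => _ [i _ <-]|exists j].
Qed.

Lemma sup_nrm_le F K : (forall j, nrm (F j) <= K) -> sup_nrm F <= K.
Proof.
by move=> FK; apply: ge_sup; [exists (nrm (F 0%N)), 0%N|move=> _ [j _ <-]].
Qed.

Lemma bounded_L2_subspace : subspace bounded_L2.
Proof.
split.
  split; first by move=> j; exact: L2_0.
  by exists 0 => j; rewrite nrm0.
move=> c F H [LF [K FK]] [LH [K' HK']]; split; first by move=> j; exact: L2_lin.
exists (`|c| * K + K') => j; apply: le_trans (nrm_lin_le c (LF j) (LH j)) _.
by rewrite lerD// ler_wpM2l.
Qed.

Lemma bounded_L2_delta j u : L2 u -> bounded_L2 (delta j u).
Proof.
move=> Lu; split.
  by move=> i; rewrite /delta; case: eqP => // _; exact: L2_0.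
exists (nrm u) => i; rewrite /delta; case: eqP => // _.
by rewrite nrm0 nrm_ge0.
Qed.

Lemma bounded_L2_trunc n F : (forall j, L2 (F j)) -> bounded_L2 (trunc n F).
Proof.
move=> LF; elim: n => [|n IH].
  have -> : trunc 0 F = 0 by apply/funext.
  by case: bounded_L2_subspace.
have -> : trunc n.+1 F = delta n (F n) + trunc n F.
  apply/funext => i; apply/funext => x; rewrite /trunc /delta ltnS leq_eqVlt.
  rewrite !fctE; have [->|ni] := eqVneq i n; first by rewrite ltnn addr0.
  by rewrite /= add0r.
apply: subspaceD => //; first exact: bounded_L2_subspace.
exact: bounded_L2_delta.
Qed.

Lemma sup_nrm_sublinear M : 0 <= M ->
  sublinear_on bounded_L2 (fun F => M * sup_nrm F).
Proof.
move=> M0; have sE := bounded_L2_subspace.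
have le1 c F : 0 <= c -> bounded_L2 F -> sup_nrm (c *: F) <= c * sup_nrm F.
  move=> c0 EF; apply: sup_nrm_le => j.
  have LF : L2 (F j) by case: EF.
  by rewrite [leLHS](nrmZ c LF) ger0_norm// ler_wpM2l// nrm_le_sup.
split=> [c F|F H EF EH].
  rewrite le_eqVlt => /predU1P[<- EF|c0 EF].
    rewrite scale0r mul0r; apply/eqP; rewrite mulf_eq0; apply/orP; right.
    apply/eqP/le_anti/andP; split.
      by apply: sup_nrm_le => j; rewrite nrm0.
    have E0 : bounded_L2 0 by case: sE.
    by apply: le_trans (nrm_le_sup 0%N E0); exact: nrm_ge0.
  rewrite mulrCA; congr *%R; apply/le_anti; rewrite le1 ?(ltW c0)//=.
  rewrite -ler_pdivlMl// -[in leLHS](scalerK (lt0r_neq0 c0) F) le1 ?invr_ge0 ?ltW//.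
  exact: subspaceZ.
rewrite -mulrDr ler_wpM2l//; apply: sup_nrm_le => j.
have LF : L2 (F j) by case: EF.
have LH : L2 (H j) by case: EH.
apply: le_trans (nrmD_le LF LH) _.
by rewrite lerD// nrm_le_sup.
Qed.

(** Extend the functional and let h_j represent it on the j-th coordinate. Testing on finite
    sequences of normalised h_j bounds the sum of the norms, and for a sequence tending to 0 the
    remainder after truncation is small in the supremum norm. That [G] is single-valued follows from
    the domination by M K, so a functional can be transported along a non-injective map. *)
Theorem c0_L2_dual (M : R) (G : set (V * R)) : 0 <= M ->
  G (0, 0) ->
  (forall (c : R) g h, G g -> G h -> G (c *: g.1 + h.1, c * g.2 + h.2)) ->
  (forall g, G g -> forall j, L2 (g.1 j)) ->
  (forall g, G g -> forall e, 0 < e ->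
     exists N, forall j, (N <= j)%N -> nrm (g.1 j) <= e) ->
  (forall g, G g -> forall K, (forall j, nrm (g.1 j) <= K) -> g.2 <= M * K) ->
  exists h : nat -> T -> R, [/\ forall j, L2 (h j),
    forall n, \sum_(j < n) nrm (h j) <= M &
    forall g, G g -> \sum_(j < n) inner (g.1 j) (h j) @[n --> \oo] --> g.2].
Proof.
move=> M0 G0 GG GL Gc GM.
have sE := bounded_L2_subspace.
have GE g : G g -> bounded_L2 g.1.
  move=> Gg; split; first exact: GL.
  have [N gN] := Gc g Gg 1 ltr01.
  exists (1 + \sum_(j < N) nrm (g.1 j)) => j.
  have [Nj|jN] := leqP N j.
    by apply: le_trans (gN j Nj) _; rewrite lerDl sumr_ge0// => i _; exact: nrm_ge0.
  rewrite (bigD1 (Ordinal jN))//= addrCA lerDl addr_ge0// sumr_ge0// => i _.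
  exact: nrm_ge0.
have [L [Llin Lle LG]] :=
  hahn_banach sE (sup_nrm_sublinear M0) G0 GG
    (fun g Gg => conj (GE g Gg) (GM g Gg _ (fun j => nrm_le_sup j (GE g Gg)))).
have E0 : bounded_L2 0 by case: sE.
have L0 : L 0 = 0.
  by have := Llin 1 0 0 E0 E0; rewrite scaler0 addr0 mul1r; lra.
have LN F : bounded_L2 F -> L (- F) = - L F.
  by move=> EF; have := Llin (-1) _ _ EF E0; rewrite addr0 scaleN1r L0; lra.
have Labs F : bounded_L2 F -> `|L F| <= M * sup_nrm F.
  move=> EF; rewrite ler_norml Lle// andbT lerNl -LN//.
  have EN := subspaceN sE EF; apply: le_trans (Lle _ EN) _.
  rewrite ler_wpM2l//; apply: sup_nrm_le => j.
  have LF : L2 (F j) by case: EF.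
  by rewrite [leLHS](nrmN LF) nrm_le_sup.
have /choice[h hP] : forall j, exists h, L2 h /\
    forall u, L2 u -> L (delta j u) = inner u h.
  move=> j; have [|u Lu|h Lh hu] := @L2_riesz _ _ _ m (fun u => L (delta j u)) M.
  - move=> c u v Lu Lv; rewrite -Llin; [|exact: bounded_L2_delta..].
    congr L; apply/funext => i; rewrite /delta; apply/funext => x.
    by rewrite !fctE; case: eqP => // _; rewrite scaler0 addr0.
  - apply: le_trans (Labs _ (bounded_L2_delta j Lu)) _; rewrite ler_wpM2l//.
    apply: sup_nrm_le => i; rewrite /delta; case: eqP => // _.
    by rewrite nrm0 nrm_ge0.
  - by exists h.
have Lh j : L2 (h j) by case: (hP j).
have Lsum F n : (forall j, L2 (F j)) ->
    L (trunc n F) = \sum_(j < n) inner (F j) (h j).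
  move=> LF; elim: n => [|n IH].
    by rewrite big_ord0 -L0; congr L; apply/funext.
  have -> : trunc n.+1 F = 1 *: delta n (F n) + trunc n F.
    apply/funext => i; apply/funext => x; rewrite /trunc /delta ltnS leq_eqVlt.
    rewrite scale1r !fctE; have [->|ni] := eqVneq i n; first by rewrite ltnn addr0.
    by rewrite /= add0r.
  rewrite Llin; [|exact: bounded_L2_delta|exact: bounded_L2_trunc].
  by rewrite mul1r IH big_ord_recr/= addrC; congr +%R; case: (hP n) => _; apply.
exists h; split=> // [n|g Gg].
  (* If |h_j| = 0 its inverse is 0, so F j vanishes and contributes 0 = |h_j|. *)
  pose F : V := fun j => fun x => (nrm (h j))^-1 * h j x.
  have LF j : L2 (F j) by exact: L2Z.
  have := Lle _ (bounded_L2_trunc n LF); rewrite Lsum//.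
  have -> : \sum_(j < n) inner (F j) (h j) = \sum_(j < n) nrm (h j).
    apply: eq_bigr => j _; rewrite /F innerZl// -sqr_nrm.
    have [->|h0] := eqVneq (nrm (h j)) 0; first by rewrite expr0n mulr0.
    by rewrite expr2 mulKf.
  move=> /le_trans; apply; rewrite -[leRHS]mulr1 ler_wpM2l//.
  apply: sup_nrm_le => j; rewrite /trunc; case: ifP => _; last by rewrite nrm0.
  rewrite /F nrmZ// ger0_norm ?invr_ge0 ?nrm_ge0//.
  have [->|h0] := eqVneq (nrm (h j)) 0; first by rewrite mulr0.
  by rewrite mulVf.
apply/cvgrPdist_le => e e0.
have e1 : 0 < e / (M + 1) by rewrite divr_gt0// ltr_wpDl.
have [N gN] := Gc g Gg _ e1.
near=> n; rewrite -Lsum; last exact: GL.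
have Eg := GE g Gg; have En := bounded_L2_trunc n (GL g Gg).
have := Llin (-1) _ _ En Eg; rewrite scaleN1r mulN1r LG// (addrC g.2) => <-.
have EB := subspaceD sE (subspaceN sE En) Eg.
apply: le_trans (Labs _ EB) _.
apply: (@le_trans _ _ (M * (e / (M + 1)))); last first.
  rewrite mulrCA; apply: ler_piMr; first exact: ltW.
  by rewrite ler_pdivrMr ?mul1r ?lerDl// ltr_wpDl.
rewrite ler_wpM2l//; apply: sup_nrm_le => j.
have [jn|nj] := ltnP j n.
  have -> : (- trunc n g.1 + g.1) j = fun=> 0.
    by apply/funext => x; rewrite !fctE /trunc jn addrC subrr.
  by rewrite nrm0 ltW.
have -> : (- trunc n g.1 + g.1) j = g.1 j.
  by apply/funext => x; rewrite !fctE /trunc ltnNge nj/= oppr0 add0r.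
by apply: gN; apply: leq_trans nj; near: n; exact: nbhs_infty_ge.
Unshelve. all: by end_near. Qed.

End L2_sequences.

(** * The growth function rho *)

Section Orlicz.
Context {R : realType}.
Variables (Phi : R -> R) (hPhi : orlicz_assumption Phi).

Lemma powR_ge_pos (p z : R) : 0 < p -> exists2 b, 2 <= b & z <= b `^ p.
Proof.
move=> p0; exists (Num.max 2 (Num.max 0 z `^ p^-1)); first by rewrite le_max lexx.
have z0 : 0 <= Num.max 0 z by rewrite le_max lexx.
apply: (@le_trans _ _ ((Num.max 0 z `^ p^-1) `^ p)).
  by rewrite -powRrM mulVf ?gt_eqF// powRr1// le_max lexx orbT.
apply: (ge0_ler_powR (ltW p0)); rewrite ?nnegrE ?powR_ge0//.
by rewrite le_max lexx orbT.
Qed.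

(** A positive supremum has an admissible p > 0 below it. The lower type inequality at t = 1 / b,
    with b s in place of s, becomes a growth bound from below; b = 2 and s = 1 show that C > 0. *)
Lemma orlicz_lower_type : exists p C : R, [/\ 0 < p, 0 < C &
  forall b s, 1 < b -> 0 < s -> b `^ p * Phi s <= C * Phi (b * s)].
Proof.
have /andP[/ereal_sup_gt[_ [p [p0 [C PC]] <-] _] _] := orlicz_critical_type hPhi.
have PC' (b s : R) : 1 < b -> 0 < s -> b `^ p * Phi s <= C * Phi (b * s).
  move=> b1 s0; have b0 : 0 < b by exact: lt_trans b1.
  have := PC b^-1 (b * s); rewrite invr_gt0 b0 invf_lt1// b1 mulr_gt0//.
  move=> /(_ isT isT isT); rewrite mulrAC mulfV ?gt_eqF// mul1r.
  rewrite -powR_inv1 ?(ltW b0)// -powRrM mulN1r powRN -mulrAC.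
  by rewrite ler_pdivlMr ?powR_gt0// mulrC.
exists p, C; split=> //.
have := PC' 2 1; rewrite ltr1n ltr01 => /(_ isT isT).
move=> /lt_le_trans h; have := h 0; rewrite mulr_gt0 ?powR_gt0 ?(orlicz_gt0 hPhi)//.
by move=> /(_ isT); rewrite pmulr_lgt0// (orlicz_gt0 hPhi)// mulr1.
Qed.

Lemma orlicz_inj : {in `]0, +oo[%classic &, injective Phi}.
Proof.
move=> s t; rewrite !inE/= !in_itv/= !andbT => s0 t0 st.
apply/eqP; rewrite eq_le !leNgt; apply/andP; split; apply/negP.
- by move=> /(orlicz_increasing hPhi t0); rewrite st ltxx.
- by move=> /(orlicz_increasing hPhi s0); rewrite st ltxx.
Qed.

(** Growth of order p > 0 makes Phi at most y at 1 / a and at least y at b, for a and b with a^p and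
    b^p large enough; the intermediate value theorem does the rest. *)
Lemma orlicz_surj (y : R) : 0 < y -> exists2 s, 0 < s & Phi s = y.
Proof.
move=> y0; have [p [C [p0 C0 PC]]] := orlicz_lower_type.
have P1 : 0 < Phi 1 := orlicz_gt0 hPhi ltr01.
have [a a2 az] := powR_ge_pos (C * Phi 1 / y) p0.
have [b b2 bz] := powR_ge_pos (C * y / Phi 1) p0.
have a0 : 0 < a by lra.
have b0 : 0 < b by lra.
have ab : a^-1 <= b.
  by apply: (@le_trans _ _ 1); rewrite ?invf_le1//; lra.
have [s sab <-] : exists2 s, s \in `[a^-1, b] & Phi s = y.
  apply: IVT => //.
    apply: continuous_subspaceW (orlicz_continuous hPhi) => s /=.
    rewrite !in_itv/= andbT => /andP[+ _]; apply: lt_le_trans.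
    by rewrite invr_gt0.
  apply/andP; split.
    rewrite ge_min; apply/orP; left.
    have := PC a a^-1; rewrite invr_gt0 a0 mulfV ?gt_eqF// => h.
    have {}h : a `^ p * Phi a^-1 <= C * Phi 1 by apply: h; lra.
    have yC : C * Phi 1 <= a `^ p * y by rewrite -ler_pdivrMr.
    by have := le_trans h yC; rewrite ler_pM2l// powR_gt0.
  rewrite le_max; apply/orP; right.
  have := PC b 1; rewrite ltr01 mulr1 => h.
  have {}h : b `^ p * Phi 1 <= C * Phi b by apply: h => //; lra.
  have yC : C * y <= b `^ p * Phi 1 by rewrite -ler_pdivrMr.
  by have := le_trans yC h; rewrite ler_pM2l.
exists s => //; move: sab; rewrite in_itv/= => /andP[+ _]; apply: lt_le_trans.
by rewrite invr_gt0.
Qed.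

Lemma Phi_invK (y : R) : 0 < y -> Phi (Phi_inv Phi y) = y.
Proof.
move=> y0; apply: pinvK; rewrite inE/=.
have [s s0 <-] := orlicz_surj y0; exists s => //=.
by rewrite in_itv/= s0.
Qed.

Lemma Phi_inv_gt0 (y : R) : 0 < y -> 0 < Phi_inv Phi y.
Proof.
move=> y0.
have : (Phi_inv Phi @` (Phi @` `]0, +oo[%classic)) (Phi_inv Phi y).
  exists y => //; have [s s0 <-] := orlicz_surj y0; exists s => //=.
  by rewrite in_itv/= s0.
by rewrite /Phi_inv (injpinv_image _ orlicz_inj)/= in_itv/= andbT.
Qed.

(** Choose K^p >= C A. The growth bound gives Phi (K u) >= K^p t / C >= A t >= s for u the inverse
    image of t, so the inverse image of s cannot exceed K u. *)
Lemma Phi_inv_le (A : R) : 1 <= A -> exists2 K, 1 <= K &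
  forall s t, 0 < s -> 0 < t -> s <= A * t -> Phi_inv Phi s <= K * Phi_inv Phi t.
Proof.
move=> A1; have [p [C [p0 C0 PC]]] := orlicz_lower_type.
have [K K2 KC] := powR_ge_pos (C * A) p0.
exists K => [|s t s0 t0 st]; first by lra.
rewrite leNgt; apply/negP => Ks.
have K0 : 0 < K by lra.
have u0 := Phi_inv_gt0 t0.
have := orlicz_increasing hPhi (mulr_gt0 K0 u0) Ks; rewrite Phi_invK//.
have := PC K _ _ u0; rewrite Phi_invK// => h.
have {}h : K `^ p * t <= C * Phi (K * Phi_inv Phi t) by apply: h; lra.
have h2 : C * (A * t) <= K `^ p * t by rewrite mulrA ler_pM2r.
have := le_trans h2 h; rewrite ler_pM2l// => h3 h4.
by have := lt_le_trans h4 (le_trans st h3); rewrite ltxx.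
Qed.

Lemma rho_gt0 (t : R) : 0 < t -> 0 < rho Phi t.
Proof. by move=> t0; rewrite divr_gt0 ?Phi_inv_gt0 ?invr_gt0. Qed.

(** Here 1 / rho t = t Phi^-1 (1 / t). From s to t the first factor grows, and the second loses at
    most a factor K because 1 / s <= A / t. *)
Lemma rhoV_le (A : R) : 1 <= A -> exists2 K, 1 <= K &
  forall s t, 0 < s -> s <= t -> t <= A * s -> (rho Phi s)^-1 <= K * (rho Phi t)^-1.
Proof.
move=> A1; have [K K1 PK] := Phi_inv_le A1.
exists K => // s t s0 st tA; have t0 : 0 < t := lt_le_trans s0 st.
rewrite /rho !invf_div !invrK mulrA.
apply: ler_pM => //; try exact: ltW; first by rewrite ltW// Phi_inv_gt0 ?invr_gt0.
apply: PK; rewrite ?invr_gt0//.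
by rewrite ler_pdivlMr// mulrC ler_pdivrMr.
Qed.

End Orlicz.

(** * Countable families of balls in a doubling space *)

Section DoublingSpace.
Context {d : measure_display} {R : realType} {X : measurableMetricType d R}.
Variable mu : {measure set X -> \bar R}.
Hypothesis mu_borel : borel_regular mu.
Hypothesis mu_doubling : doubling mu.
Implicit Types (x y : X) (r s e : R).
Local Notation V := (V mu).

Lemma in_ball x r y : ball x r y = (mdist x y < r) :> Prop.
Proof. by rewrite ballEmdist. Qed.

Lemma ball_subset x r y s : mdist y x + r <= s -> ball x r `<=` ball y s.
Proof.
move=> xys z; rewrite !in_ball => xz.
by apply: le_lt_trans (metric_triangle y x z) _; apply: lt_le_trans xys; rewrite ltrD2l.
Qed.

Lemma ball_open_metric x r : open (ball x r).
Proof.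
rewrite openE => y; rewrite in_ball => xy.
have e0 : 0 < r - mdist x y by rewrite subr_gt0.
apply: filterS (nbhsx_ballx y _ e0); apply: ball_subset.
by rewrite addrC subrK.
Qed.

Lemma ball_measurable x r : measurable (ball x r).
Proof. by case: mu_borel => + _; apply; exact: ball_open_metric. Qed.

Lemma mu_ballE x r : 0 < r -> mu (ball x r) = (V x r)%:E.
Proof.
move=> r0; have [C1 C11 /(_ x _ r0)/andP[_ h]] := mu_doubling.
rewrite /V fineK// ge0_fin_numE//.
have C10 : (0 < C1%:E)%E by rewrite lte_fin; exact: lt_le_trans C11.
by move: h; case: (mu (ball x r)) => [s||]//; rewrite ?ltry// gt0_muley.
Qed.

Lemma V_ge0 x r : 0 <= V x r. Proof. exact: fine_ge0. Qed.

Lemma le_V x r y s : 0 < s -> ball x r `<=` ball y s -> V x r <= V y s.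
Proof.
move=> s0 xy.
have le_mu : (mu (ball x r) <= mu (ball y s))%E.
  by apply: le_measure => //; rewrite inE; exact: ball_measurable.
have fin_y : mu (ball y s) \is a fin_num by rewrite mu_ballE.
apply: fine_le => //; rewrite ge0_fin_numE//; apply: le_lt_trans le_mu _.
by rewrite mu_ballE// ltry.
Qed.

Lemma V_doubling : exists2 C1 : R, 1 <= C1 &
  forall n x r, 0 < r -> V x (2 ^+ n * r) <= C1 ^+ n * V x r.
Proof.
have [C1 C11 dbl] := mu_doubling; exists C1 => // n x r r0.
elim: n => [|n IH]; first by rewrite !expr0 !mul1r.
have rn : 0 < 2 ^+ n * r by rewrite mulr_gt0// exprn_gt0.
have /andP[+ _] := dbl x _ rn.
rewrite mu_ballE ?mulr_gt0// (mu_ballE _ rn) -EFinM lee_fin mulrA -exprS.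
move=> /le_trans; apply; rewrite exprS -mulrA ler_wpM2l//.
exact: le_trans C11.
Qed.

(** By doubling, the dilates of a null ball are null, and they exhaust the space. *)
Lemma V_gt0_or_null : (forall x r, 0 < r -> 0 < V x r) \/ mu setT = 0%E.
Proof.
have [h|/existsNP[x /existsNP[r /not_implyP[r0 /negP]]]] :=
  pselect (forall x r, 0 < r -> 0 < V x r); first by left.
rewrite lt_neqAle V_ge0 andbT negbK => /eqP/esym V0; right.
have [C1 C11 dbl] := V_doubling.
have null n : mu (ball x (2 ^+ n * r)) = 0%E.
  rewrite mu_ballE ?mulr_gt0 ?exprn_gt0//; congr EFin; apply/le_anti.
  by rewrite V_ge0 andbT; have := dbl n x r r0; rewrite V0 mulr0.
have -> : [set: X] = \bigcup_n ball x (2 ^+ n * r).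
  apply/seteqP; split=> // y _; exists (Num.truncn (mdist x y / r)).+1 => //=.
  rewrite in_ball -ltr_pdivrMr//.
  have := truncnS_gt (mdist x y / r) => /lt_le_trans; apply.
  by rewrite -natrX ler_nat ltnW// ltn_expl.
apply/eqP; rewrite eq_le measure_ge0 andbT.
have mB n : measurable (ball x (2 ^+ n * r)) by exact: ball_measurable.
apply: le_trans (measure_sigma_subadditive mu mB _ (@subset_refl _ _)) _.
  exact: bigcup_measurable.
by rewrite eseries0.
Qed.

(** Balls of radius e / 2 about e-separated points are disjoint. *)
Lemma separated_measure (s : seq X) e c : 0 < e ->
  (forall x, x \in s -> c%:E <= mu (ball x (e / 2)))%E ->
  pairwise (fun x y => e <= mdist x y) s ->
  (((size s)%:R * c)%:E <= mu (\big[setU/set0]_(x <- s) ball x (e / 2)))%E.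
Proof.
move=> e0; elim: s => [_ _|x s IH cs /=].
  by rewrite big_nil measure0 mul0r.
move=> /andP[/allP xs sep]; rewrite big_cons measureU//.
- rewrite -natr1 mulrDl mul1r addrC EFinD leeD//.
    by apply: cs; rewrite inE eqxx.
  by apply: IH => // y ys; apply: cs; rewrite inE ys orbT.
- exact: ball_measurable.
- by apply: bigsetU_measurable => y _; exact: ball_measurable.
- rewrite -subset0 => z [xz]; rewrite -bigcup_seq => -[y /= ys yz].
  have := xs _ ys; rewrite leNgt => /negP; apply.
  move: xz yz; rewrite !in_ball => xz yz.
  apply: le_lt_trans (metric_triangle x z y) _.
  by rewrite (splitr e) ltrD// metric_sym.
Qed.

(** A separated set of maximal size is a net. Sizes are bounded by about C1^k: the disjoint balls of
    radius e / 2 lie in B(x0, r + e), and by doubling each has at least the fraction C1^-k of its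
    measure. *)
Lemma finite_net (A : set X) x0 r e : (forall x r, 0 < r -> 0 < V x r) ->
  0 < r -> 0 < e -> A `<=` ball x0 r ->
  exists s : seq X, (forall x, x \in s -> A x) /\
    (forall y, A y -> exists2 x, x \in s & mdist x y < e).
Proof.
move=> V0 r0 e0 Ar; have [C1 C11 dbl] := V_doubling.
have C10 : 0 < C1 by exact: lt_le_trans C11.
(* With this k the dilate by 2^k of a ball of radius e / 2 centred in B(x0, r) contains B(x0, r +
   e). *)
pose k := (Num.truncn ((2 * r + e) / (e / 2))).+1.
have hk : 2 * r + e <= 2 ^+ k * (e / 2).
  rewrite -ler_pdivrMr ?divr_gt0//.
  apply/ltW/(lt_le_trans (truncnS_gt _)).
  by rewrite -natrX ler_nat ltnW// ltn_expl.
pose W := V x0 (r + e).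
have W0 : 0 < W by apply: V0; rewrite addr_gt0.
pose c := W / C1 ^+ k.
have cV x : A x -> (c%:E <= mu (ball x (e / 2)))%E.
  move=> /Ar; rewrite in_ball => x0x; rewrite mu_ballE ?divr_gt0// lee_fin.
  rewrite ler_pdivrMr ?exprn_gt0// mulrC; apply: le_trans (dbl _ _ _ _); last first.
    by rewrite divr_gt0.
  apply: le_V; first by rewrite mulr_gt0 ?exprn_gt0 ?divr_gt0.
  apply: ball_subset; apply: le_trans hk; rewrite metric_sym; lra.
pose P n := `[< exists s : seq X, [/\ size s = n, forall x, x \in s -> A x &
  pairwise (fun x y => e <= mdist x y) s] >].
have exP : exists n, P n by exists 0%N; apply/asboolP; exists [::].
have Pub n : P n -> (n <= (Num.truncn (C1 ^+ k)).+1)%N.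
  move=> /asboolP[s [<- sA sep]].
  rewrite -(ler_nat R); apply/ltW/(le_lt_trans _ (truncnS_gt _)).
  have := separated_measure e0 (fun x xs => cV x (sA x xs)) sep.
  have : (mu (\big[setU/set0]_(x <- s) ball x (e / 2)) <= W%:E)%E.
    rewrite -mu_ballE ?addr_gt0//; apply: le_measure; rewrite ?inE.
    - by apply: bigsetU_measurable => y _; exact: ball_measurable.
    - exact: ball_measurable.
    - rewrite -bigcup_seq => z [x /= /sA/Ar]; rewrite !in_ball => x0x xz.
      by apply: le_lt_trans (metric_triangle x0 x z) _; lra.
  move=> h1 h2; have := le_trans h2 h1; rewrite lee_fin /c.
  by rewrite mulrA ler_pdivrMr ?exprn_gt0// mulrC ler_pM2l.
have [n /asboolP[s [sn sA sep]] nmax] := ex_maxnP exP Pub.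
exists s; split=> // y Ay; apply: contrapT => ny.
have : P n.+1.
  apply/asboolP; exists (y :: s); split=> /=; first by rewrite sn.
    by move=> x; rewrite inE => /predU1P[->//|/sA].
  rewrite sep andbT; apply/allP => x xs; rewrite leNgt; apply/negP.
  by rewrite metric_sym => xy; apply: ny; exists x.
by move=> /nmax; rewrite ltnn.
Qed.

(** Positive integers and their inverses: every r > 0 has one of them between r and 2 r, and only
    finitely many lie in a compact subset of (0, oo). *)
Definition net_radius (b : bool) (n : nat) : R :=
  if b then n.+1%:R else n.+1%:R^-1.

Lemma net_radius_gt0 b n : 0 < net_radius b n.
Proof. by rewrite /net_radius; case: b; rewrite ?invr_gt0 ltr0n. Qed.

Lemma net_radiusP r : 0 < r ->
  exists b n, r <= net_radius b n <= 2 * r.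
Proof.
move=> r0; have [r1|r1] := leP 1 r.
  exists true, (Num.truncn r); rewrite /net_radius ltW ?truncnS_gt//=.
  have := truncn_le r; rewrite (ltW r0) -natr1; lra.
have k1 : (0 < Num.truncn r^-1)%N by rewrite truncn_gt0 invf_ge1// ltW.
exists false, (Num.truncn r^-1).-1; rewrite /net_radius prednK//.
have k0 : 0 < (Num.truncn r^-1)%:R :> R by rewrite ltr0n.
rewrite -[X in X <= _ <= _]invrK lef_pV2 ?posrE ?invr_gt0//.
apply/andP; split; first by have := truncn_le r^-1; rewrite invr_ge0 (ltW r0).
rewrite -[leRHS]invrK lef_pV2 ?posrE ?invr_gt0 ?mulr_gt0//.
rewrite invfM ler_pdivrMl//; apply/ltW/(lt_le_trans (truncnS_gt _)).
by rewrite -natrM ler_nat mul2n -addnn -addn1 leq_add2l.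
Qed.

(** For every [net_radius] R and every annulus q <= d(x0, y) < q + 1, take a finite R-net of the
    annulus and the balls of radius 2 R about it. Balls are indexed by the codes of (radius,
    annulus, position in the net), with [None] at codes naming no ball. The three alternatives of
    the last clause match the three vanishing conditions. *)
Lemma doubling_ball_family x0 : exists (B : nat -> option (X * R)) (K : R),
  [/\ 1 <= K,
    forall j y s, B j = Some (y, s) -> 0 < s /\ 0 < V y s,
    forall x r, 0 < r -> 0 < V x r -> exists j y s,
      [/\ B j = Some (y, s), ball x r `<=` ball y s & V y s <= K * V x r] &
    forall c, 0 < c -> exists N, forall j y s, (N <= j)%N -> B j = Some (y, s) ->
      [\/ s < c^-1, c < s | c < mdist x0 y]].
Proof.
have [V0|null] := V_gt0_or_null; last first.
  exists (fun=> None), 1; split=> // [x r r0|c _]; last by exists 0%N.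
  suff -> : V x r = 0 by rewrite ltxx.
  apply/le_anti; rewrite V_ge0 andbT -lee_fin -mu_ballE//.
  apply: (@le_trans _ _ (mu setT)); last by rewrite null.
  by apply: le_measure => //; rewrite inE//; exact: ball_measurable.
pose ann (q : nat) : set X := [set y | q%:R <= mdist x0 y < q.+1%:R].
have /choice[S SP] : forall t : bool * nat * nat, exists s : seq X,
    (forall x, x \in s -> ann t.2 x) /\
    (forall y, ann t.2 y -> exists2 x, x \in s & mdist x y < net_radius t.1.1 t.1.2).
  move=> [[b n] q] /=; apply: (@finite_net _ x0 q.+1%:R) => //.
    exact: net_radius_gt0.
  by move=> y /andP[_]; rewrite in_ball.
pose dec (t : bool * nat * nat * nat) : option (X * R) :=
  if (t.2 < size (S t.1))%N
  then Some (nth x0 (S t.1) t.2, 2 * net_radius t.1.1.1 t.1.1.2) else None.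
have decP t y s : dec t = Some (y, s) ->
    [/\ (t.2 < size (S t.1))%N, ann t.1.2 y & s = 2 * net_radius t.1.1.1 t.1.1.2].
  rewrite /dec; case: ifP => // ts [<- <-]; split=> //.
  by have [h _] := SP t.1; apply: h; exact: mem_nth.
have [C1 C11 dbl] := V_doubling.
(* For r <= R <= 2 r and d(x, y) < R, the ball B(y, 2 R) lies in B(x, 3 R), hence in B(x, 8 r):
   three doublings. *)
exists (fun j => obind dec (pickle_inv j)), (C1 ^+ 3); split.
- exact: exprn_ege1.
- move=> j y s; case: (pickle_inv j) => //= t /decP[_ _ ->].
  have s0 := net_radius_gt0 t.1.1.1 t.1.1.2.
  by split; [|apply: V0]; rewrite mulr_gt0.
- move=> x r r0 _; have [b [n /andP[rr rr2]]] := net_radiusP r0.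
  pose q := Num.truncn (mdist x0 x).
  have annx : ann q x by rewrite /ann/= truncnS_gt andbT truncn_le mdist_ge0.
  have [_ /(_ _ annx)[y yS yx]] := SP (b, n, q).
  exists (pickle (b, n, q, index y (S (b, n, q)))), y, (2 * net_radius b n); split.
  + by rewrite pickleK_inv/= /dec/= index_mem yS nth_index.
  + by apply: ball_subset; move: yx => /=; lra.
  + apply: le_trans (dbl 3%N x r r0); apply: le_V.
      by rewrite mulr_gt0// exprn_gt0.
    apply: ball_subset; rewrite metric_sym; move: yx => /=.
    by rewrite !exprS expr0; lra.
(* A radius 2 R in [1 / c, c] forces n + 1 <= 2 c, and a centre within c of x0 forces q <= c. N is
   the largest of the finitely many codes that remain. *)
- move=> c c0; pose M := (Num.truncn (2 * c)).+1.
  pose N := (\max_(b : bool) \max_(n < M) \max_(q < M)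
    \max_(i < size (S (b, nat_of_ord n, nat_of_ord q)))
      pickle (b, nat_of_ord n, nat_of_ord q, nat_of_ord i))%N.
  exists N.+1 => j y s Nj; have := @pickle_invK (bool * nat * nat * nat)%type j.
  case: (pickle_inv j) => //= -[[[b n] q] i] tj.
  move=> /decP/= [iS /andP[qy _] ->].
  have [h1|h1] := ltP (2 * net_radius b n) c^-1; first by constructor 1.
  have [h2|h2] := ltP c (2 * net_radius b n); first by constructor 2.
  have [h3|h3] := ltP c (mdist x0 y); first by constructor 3.
  exfalso; move: Nj; rewrite -tj ltnNge => /negP; apply.
  have lt_M k : k%:R <= 2 * c -> (k < M)%N.
    by move=> kc; rewrite ltnS truncn_ge_nat// mulr_ge0// ltW.
  have qM : (q < M)%N by apply: lt_M; lra.
  have nM : (n < M)%N.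
    apply: lt_M; move: h1 h2; rewrite /net_radius; case: (b) => h1 h2.
      by move: h2; rewrite -natr1; have := ler0n R n; lra.
    move: h1; rewrite ler_pdivlMr ?ltr0n// mulrC ler_pdivrMr// -natr1; lra.
  apply: leq_trans (leq_bigmax b).
  apply: leq_trans (leq_bigmax (Ordinal nM)).
  apply: leq_trans (leq_bigmax (Ordinal qM)).
  exact: leq_trans (leq_bigmax (Ordinal iS)).
Qed.

End DoublingSpace.

(** * Tents and the pairing *)

Section Tents.
Context {d : measure_display} {R : realType} {X : measurableMetricType d R}.
Variable mu : {measure set X -> \bar R}.
Hypothesis mu_borel : borel_regular mu.
Local Notation XR := (X * measurableTypeR R)%type.
Implicit Types (f g h a : XR -> R[i]) (D : set XR) (p : R[i] -> R).
Local Notation m := (mu \x @lebesgue_measure R)%E.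

Lemma upper_measurable : measurable (upper : set XR).
Proof. by apply: measurableX => //; exact: measurable_itv. Qed.

(** The complement in [upper], where the distance to the complement of the ball is less than t, is
    the union over rational q of the sets where that distance is below q and t >= q; these are
    products with an open first factor. *)
Lemma tent_measurable (x : X) (r : R) : measurable (tent (ball x r)).
Proof.
pose near_compl (q : rat) : set X :=
  [set y | exists2 y', ~ ball x r y' & mdist y y' < ratr q].
have near_compl_open q : open (near_compl q).
  rewrite openE => y [y' y'B yy'].
  have e0 : 0 < ratr q - mdist y y' by rewrite subr_gt0.
  apply: filterS (nbhsx_ballx y _ e0) => z; rewrite in_ball => yz.
  exists y' => //; apply: le_lt_trans (metric_triangle z y y') _.
  by rewrite metric_sym -ltrBrDr.
have -> : tent (ball x r) =
    upper `\` \bigcup_q (near_compl q `*` `[ratr q, +oo[%classic).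
  apply/seteqP; split=> [[y t] [uz /= dz]|[y t] [uz nz]]; split=> //.
    move=> [q _ /= [[y' y'B yy']]]; rewrite in_itv/= andbT => qt.
    suff : (t%:E <= (mdist y y')%:E)%E.
      by rewrite lee_fin leNgt (lt_le_trans yy' qt).
    by apply: le_trans dz _; apply: ereal_inf_lbound; exists y'.
  apply: le_ereal_inf_tmp => _ [y' y'B <-] /=; rewrite lee_fin leNgt.
  apply/negP => /rat_in_itvoo[q]; rewrite in_itv/= => /andP[yq qt].
  by apply: nz; exists q => //; split; [exists y'|rewrite /= in_itv/= andbT ltW].
apply: measurableD; first exact: upper_measurable.
apply: bigcupT_measurable_rat => q; apply: measurableX => //.
by case: mu_borel => + _; apply.
Qed.

Lemma tent_upper (x : X) (r : R) : tent (ball x r) `<=` upper.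
Proof. by move=> z []. Qed.

Lemma subset_tent (A B : set X) : A `<=` B -> tent A `<=` tent B.
Proof.
move=> AB z [uz Az]; split=> //; apply: le_trans Az _.
apply: le_ereal_inf => _ [y By <-]; exists y => //.
by move=> /AB.
Qed.

Lemma upper_gt0 (z : XR) : upper z -> 0 < z.2.
Proof. by case=> _ /=; rewrite in_itv/= andbT. Qed.

(* Multiplication by t^(-1/2) turns L^2(D, dmu dt / t) into L^2(D, dmu dt). *)
Definition weighted D p f : XR -> R :=
  (fun z => p (f z) * z.2 `^ (- 2^-1)) \_ D.

Lemma weightedE D p f z :
  weighted D p f z = if z \in D then p (f z) * z.2 `^ (- 2^-1) else 0.
Proof. by rewrite /weighted patchE. Qed.

Lemma sqr_powRNhalf (t : R) : 0 < t -> (t `^ (- 2^-1)) ^+ 2 = t^-1.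
Proof.
move=> t0; rewrite -powR_mulrn ?powR_ge0// -powRrM mulNr mulVf//.
by rewrite powR_inv1// ltW.
Qed.

Lemma measurable_weight D (p : R) : measurable_fun D (fun z : XR => z.2 `^ p).
Proof.
apply: measurable_funTS.
exact: (measurableT_comp (measurable_powR p) (@measurable_snd _ _ X (measurableTypeR R))).
Qed.

Lemma measurable_weighted D p f : measurable D -> D `<=` upper ->
  measurable_fun upper (fun z => p (f z)) -> measurable_fun setT (weighted D p f).
Proof.
move=> mD Du mpf; apply/(measurable_restrictT _ mD).
apply: measurable_funM; last exact: measurable_weight.
by apply: measurable_funS mpf => //; exact: upper_measurable.
Qed.

Lemma normc_sqr (c : R[i]) :
  ComplexField.Normc.normc c ^+ 2 = complex.Re c ^+ 2 + complex.Im c ^+ 2.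
Proof. by case: c => x y /=; rewrite sqr_sqrtr// addr_ge0 ?sqr_ge0. Qed.

Lemma sqintE D f : measurable D -> D `<=` upper -> cmeasurable f ->
  sqint mu D f = (\int[m]_z (weighted D (@complex.Re R) f z ^+ 2)%:E +
                  \int[m]_z (weighted D (@complex.Im R) f z ^+ 2)%:E)%E.
Proof.
move=> mD Du [mRe mIm]; rewrite /sqint integral_mkcond.
rewrite -ge0_integralD//; first last.
- by apply: measurable_sqE; exact: measurable_weighted.
- by move=> z _; rewrite lee_fin sqr_ge0.
- by apply: measurable_sqE; exact: measurable_weighted.
- by move=> z _; rewrite lee_fin sqr_ge0.
apply: eq_integral => z _; rewrite !weightedE patchE.
case: ifPn => [|_]; last by rewrite expr0n/= adde0.
rewrite inE => Dz; rewrite -EFinD !exprMn sqr_powRNhalf ?normc_sqr ?mulrDl//.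
exact/upper_gt0/Du.
Qed.

Lemma sqint_ge0 D f : D `<=` upper -> (0 <= sqint mu D f)%E.
Proof.
move=> Du; apply: integral_ge0 => z /Du/upper_gt0 z0.
by rewrite lee_fin mulr_ge0 ?sqr_ge0// invr_ge0 ltW.
Qed.

(** * Square-integrable functions over a fixed region *)

Section finite.
Variables (D : set XR) (mD : measurable D) (Du : D `<=` upper).

Lemma L2_weighted f : cmeasurable f -> (sqint mu D f < +oo)%E ->
  L2 m (weighted D (@complex.Re R) f) /\ L2 m (weighted D (@complex.Im R) f).
Proof.
move=> mf; rewrite sqintE//.
have ge0 p : (0 <= \int[m]_z (weighted D p f z ^+ 2)%:E)%E.
  by apply: integral_ge0 => z _; rewrite lee_fin sqr_ge0.
move=> fin; split; split.
- by apply: measurable_weighted => //; case: mf.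
- by apply: le_lt_trans fin; rewrite leeDl.
- by apply: measurable_weighted => //; case: mf.
- by apply: le_lt_trans fin; rewrite leeDr.
Qed.

Lemma sqint_nrm f : cmeasurable f -> (sqint mu D f < +oo)%E ->
  sqint mu D f = (nrm m (weighted D (@complex.Re R) f) ^+ 2 +
                  nrm m (weighted D (@complex.Im R) f) ^+ 2)%:E.
Proof.
move=> mf fin; have [LR LI] := L2_weighted mf fin.
by rewrite sqintE// !integral_sqE.
Qed.

Definition wnrm f : R := Num.sqrt (fine (sqint mu D f)).

Lemma wnrm_ge0 f : 0 <= wnrm f. Proof. exact: sqrtr_ge0. Qed.

Lemma nrm_le_wnrm f : cmeasurable f -> (sqint mu D f < +oo)%E ->
  nrm m (weighted D (@complex.Re R) f) <= wnrm f /\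
  nrm m (weighted D (@complex.Im R) f) <= wnrm f.
Proof.
move=> mf fin; rewrite /wnrm sqint_nrm//=.
by split; rewrite -[leLHS]ger0_norm ?nrm_ge0// -sqrtr_sqr ler_wsqrtr//
  ?lerDl ?lerDr ?sqr_ge0.
Qed.

Lemma wnrm_le f : cmeasurable f -> (sqint mu D f < +oo)%E ->
  wnrm f <= nrm m (weighted D (@complex.Re R) f) + nrm m (weighted D (@complex.Im R) f).
Proof.
move=> mf fin; rewrite /wnrm sqint_nrm//=.
have a0 := nrm_ge0 m (weighted D (@complex.Re R) f).
have b0 := nrm_ge0 m (weighted D (@complex.Im R) f).
rewrite -[leRHS]ger0_norm ?addr_ge0// -sqrtr_sqr ler_wsqrtr//.
by rewrite sqrrD lerD2r lerDl mulrn_wge0// mulr_ge0.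
Qed.

(** The density 1 / t is shared as t^(-1/2) between both factors, and the integrand vanishes off [D]
    with a. *)
Lemma pairingE f a : cmeasurable f -> cmeasurable a ->
  (sqint mu D f < +oo)%E -> (sqint mu D a < +oo)%E ->
  [set z | upper z /\ a z != 0] `<=` D ->
  pairing mu f a = Complex
    (inner m (weighted D (@complex.Re R) f) (weighted D (@complex.Re R) a) -
     inner m (weighted D (@complex.Im R) f) (weighted D (@complex.Im R) a))
    (inner m (weighted D (@complex.Re R) f) (weighted D (@complex.Im R) a) +
     inner m (weighted D (@complex.Im R) f) (weighted D (@complex.Re R) a)).
Proof.
move=> mf ma ff fa aD.
have [fR fI] := L2_weighted mf ff.
have [aR aI] := L2_weighted ma fa.
have supp z : upper z -> z \notin D -> a z = 0.
  move=> uz zD; apply/eqP/negPn/negP => az.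
  by move/negP: zD; apply; rewrite inE; apply: aD.
have offD z : z \notin upper -> z \notin D.
  by move=> zu; apply: contra zu; rewrite !inE => /Du.
have sq (z : XR) : upper z -> z.2^-1 = (z.2 `^ (- 2^-1)) * (z.2 `^ (- 2^-1)).
  by move=> uz; rewrite -(sqr_powRNhalf (upper_gt0 uz)) expr2.
rewrite /pairing /inner; congr Complex; rewrite Rintegral_mkcond.
- rewrite -RintegralB//; [|exact: integrable_mulL2..].
  apply: eq_Rintegral => z _; rewrite !weightedE patchE.
  have [uz|/offD zD] := boolP (z \in upper); last by rewrite (negbTE zD) !mul0r subrr.
  have uz' : upper z by rewrite inE in uz.
  have [Dz|zD] := boolP (z \in D); last first.
    by rewrite (supp z)// mulr0/= !mul0r subrr.
  by rewrite (sq z)//; case: (f z) (a z) => u v [u' v'] /=; ring.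
- rewrite -RintegralD//; [|exact: integrable_mulL2..].
  apply: eq_Rintegral => z _; rewrite !weightedE patchE.
  have [uz|/offD zD] := boolP (z \in upper); last by rewrite (negbTE zD) !mul0r addr0.
  have uz' : upper z by rewrite inE in uz.
  have [Dz|zD] := boolP (z \in D); last first.
    by rewrite (supp z)// mulr0/= !mul0r addr0.
  by rewrite (sq z)//; case: (f z) (a z) => u v [u' v'] /=; ring.
Qed.

Lemma normc_le_ReIm (c : R[i]) :
  ComplexField.Normc.normc c <= `|complex.Re c| + `|complex.Im c|.
Proof.
rewrite -[leRHS]ger0_norm ?addr_ge0// -sqrtr_sqr; case: c => x y /=.
by rewrite ler_wsqrtr// sqrrD !real_normK ?num_real// lerD2r lerDl mulrn_wge0.
Qed.

(** Cauchy-Schwarz is applied to each of the four real inner products of the complex product; hence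
    the factor 4, which becomes the constant of the first half. *)
Lemma pairing_le f a : cmeasurable f -> cmeasurable a ->
  (sqint mu D f < +oo)%E -> (sqint mu D a < +oo)%E ->
  [set z | upper z /\ a z != 0] `<=` D ->
  ComplexField.Normc.normc (pairing mu f a) <= 4 * (wnrm f * wnrm a).
Proof.
move=> mf ma ff fa aD; rewrite (pairingE mf ma ff fa aD).
have [fR fI] := L2_weighted mf ff.
have [aR aI] := L2_weighted ma fa.
have [nfR nfI] := nrm_le_wnrm mf ff.
have [naR naI] := nrm_le_wnrm ma fa.
have bnd u v : L2 m u -> L2 m v -> nrm m u <= wnrm f -> nrm m v <= wnrm a ->
    `|inner m u v| <= wnrm f * wnrm a.
  move=> Lu Lv uf va; apply: le_trans (normr_inner_le Lu Lv) _.
  by rewrite ler_pM ?nrm_ge0.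
apply: le_trans (normc_le_ReIm _) _ => /=.
apply: le_trans (lerD (ler_normB _ _) (ler_normD _ _)) _.
have := bnd _ _ fR aR nfR naR; have := bnd _ _ fI aI nfI naI.
have := bnd _ _ fR aI nfR naI; have := bnd _ _ fI aR nfI naR.
lra.
Qed.

Lemma cmeasurable_lin (c : R[i]) f h : cmeasurable f -> cmeasurable h ->
  cmeasurable (fun z => c * f z + h z).
Proof.
case: c => x y [fR fI] [hR hI]; split.
  rewrite [X in measurable_fun _ X](_ : _ = fun z =>
      x * complex.Re (f z) - y * complex.Im (f z) + complex.Re (h z)); last first.
    by apply/funext => z; case: (f z) (h z) => ? ? [].
  apply: measurable_funD => //; apply: measurable_funB;
    by apply: measurable_funM => //; exact: measurable_cst.
rewrite [X in measurable_fun _ X](_ : _ = fun z =>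
    x * complex.Im (f z) + y * complex.Re (f z) + complex.Im (h z)); last first.
  by apply/funext => z; case: (f z) (h z) => ? ? [].
by apply: measurable_funD => //; apply: measurable_funD;
  apply: measurable_funM => //; exact: measurable_cst.
Qed.

Lemma weightedRe_lin (c : R[i]) f h :
  weighted D (@complex.Re R) (fun z => c * f z + h z) = fun z =>
    complex.Re c * weighted D (@complex.Re R) f z +
    (- complex.Im c * weighted D (@complex.Im R) f z +
     weighted D (@complex.Re R) h z).
Proof.
apply/funext => z; rewrite !weightedE; case: ifP => _; last by rewrite !mulr0 !addr0.
by case: c => x y; case: (f z) => u v; case: (h z) => u' v' /=; ring.
Qed.

Lemma weightedIm_lin (c : R[i]) f h :
  weighted D (@complex.Im R) (fun z => c * f z + h z) = fun z =>
    complex.Re c * weighted D (@complex.Im R) f z +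
    (complex.Im c * weighted D (@complex.Re R) f z +
     weighted D (@complex.Im R) h z).
Proof.
apply/funext => z; rewrite !weightedE; case: ifP => _; last by rewrite !mulr0 !addr0.
by case: c => x y; case: (f z) => u v; case: (h z) => u' v' /=; ring.
Qed.

Lemma sqint_lin (c : R[i]) f h : cmeasurable f -> cmeasurable h ->
  (sqint mu D f < +oo)%E -> (sqint mu D h < +oo)%E ->
  (sqint mu D (fun z => c * f z + h z)%R < +oo)%E.
Proof.
move=> mf mh ff fh; rewrite sqintE//; last exact: cmeasurable_lin.
have [fR fI] := L2_weighted mf ff.
have [hR hI] := L2_weighted mh fh.
rewrite weightedRe_lin weightedIm_lin; apply: lte_add_pinfty.
  by have [] := L2_lin (complex.Re c) fR (L2_lin (- complex.Im c) fI hR).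
by have [] := L2_lin (complex.Re c) fI (L2_lin (complex.Im c) fR hI).
Qed.

(** A crude triangle inequality, one real part at a time; the constants are harmless because it only
    serves to show that the tent spaces are closed under linear combinations. *)
Lemma wnrm_lin (c : R[i]) f h : cmeasurable f -> cmeasurable h ->
  (sqint mu D f < +oo)%E -> (sqint mu D h < +oo)%E ->
  wnrm (fun z => c * f z + h z) <=
    2 * (`|complex.Re c| + `|complex.Im c|) * wnrm f + 2 * wnrm h.
Proof.
move=> mf mh ff fh.
have [fR fI] := L2_weighted mf ff.
have [hR hI] := L2_weighted mh fh.
have [nfR nfI] := nrm_le_wnrm mf ff.
have [nhR nhI] := nrm_le_wnrm mh fh.
apply: le_trans (wnrm_le (cmeasurable_lin c mf mh) (sqint_lin c mf mh ff fh)) _.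
rewrite weightedRe_lin weightedIm_lin.
have H1 := nrm_lin_le (complex.Re c) fR (L2_lin (- complex.Im c) fI hR).
have H2 := nrm_lin_le (- complex.Im c) fI hR.
have H3 := nrm_lin_le (complex.Re c) fI (L2_lin (complex.Im c) fR hI).
have H4 := nrm_lin_le (complex.Im c) fR hI.
rewrite normrN in H2.
have E1 := ler_wpM2l (normr_ge0 (complex.Re c)) nfR.
have E2 := ler_wpM2l (normr_ge0 (complex.Re c)) nfI.
have E3 := ler_wpM2l (normr_ge0 (complex.Im c)) nfR.
have E4 := ler_wpM2l (normr_ge0 (complex.Im c)) nfI.
apply: le_trans (lerD (le_trans H1 (lerD E1 (le_trans H2 (lerD E4 nhR))))
  (le_trans H3 (lerD E2 (le_trans H4 (lerD E3 nhI))))) _.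
lra.
Qed.

Lemma weightedZ (c : R) f :
  weighted D (@complex.Re R) (fun z => Complex c 0 * f z) =
    (fun z => c * weighted D (@complex.Re R) f z) /\
  weighted D (@complex.Im R) (fun z => Complex c 0 * f z) =
    (fun z => c * weighted D (@complex.Im R) f z).
Proof.
split; apply/funext => z; rewrite !weightedE; case: ifP => _; rewrite ?mulr0//;
  by case: (f z) => u v /=; ring.
Qed.

(** Here the constant is exact, since rescaling f to norm at most 1 must not cost a factor. *)
Lemma sqintZ (c : R) f : cmeasurable f -> (sqint mu D f < +oo)%E ->
  sqint mu D (fun z => Complex c 0 * f z) = ((c ^+ 2)%:E * sqint mu D f)%E.
Proof.
move=> mf ff; have [fR fI] := L2_weighted mf ff.
have mcf : cmeasurable (fun z => Complex c 0 * f z).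
  have m0 : cmeasurable (fun _ : XR => 0 : R[i]) by split; exact: measurable_cst.
  have := cmeasurable_lin (Complex c 0) mf m0.
  by under [X in cmeasurable X -> _]eq_fun do rewrite addr0.
have [eR eI] := weightedZ c f.
rewrite sqintE// eR eI !integral_sqE; [|exact: L2Z..].
by rewrite !nrmZ// sqint_nrm// -EFinM -EFinD !exprMn real_normK ?num_real// mulrDr.
Qed.

End finite.
End Tents.

(** * The tent spaces *)

Section TinfSpaces.
Context {d : measure_display} {R : realType} {X : measurableMetricType d R}.
Variable mu : {measure set X -> \bar R}.
Hypothesis mu_borel : borel_regular mu.
Hypothesis mu_doubling : doubling mu.
Variables (Phi : R -> R) (hPhi : orlicz_assumption Phi) (x0 : X).
Local Notation XR := (X * measurableTypeR R)%type.
Implicit Types (f g h a : XR -> R[i]) (x y : X) (r s : R).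
Local Notation m := (mu \x @lebesgue_measure R)%E.
Local Notation V := (V mu).
Local Notation normc := ComplexField.Normc.normc.
Local Notation tnt x r := (tent (ball x r)).
Local Notation Tinf := (Tinf mu Phi).
Local Notation Tinf_norm := (Tinf_norm mu Phi).
Local Notation Q := (Q mu Phi).
Local Notation Tinf_v := (Tinf_v mu Phi x0).

Definition ball_weight x r : R := (rho Phi (V x r))^-1 * Num.sqrt (V x r)^-1.

Lemma ball_weight_ge0 x r : 0 <= ball_weight x r.
Proof.
rewrite /ball_weight; have [V0|V0] := eqVneq (V x r) 0.
  by rewrite V0 invr0 sqrtr0 mulr0.
rewrite mulr_ge0 ?sqrtr_ge0// invr_ge0 ltW// rho_gt0//.
by rewrite lt_neqAle eq_sym V0 V_ge0.
Qed.

Lemma sqr_ball_weight x r :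
  ball_weight x r ^+ 2 = (V x r)^-1 * rho Phi (V x r) ^- 2.
Proof. by rewrite exprMn sqr_sqrtr ?invr_ge0 ?V_ge0// exprVn mulrC. Qed.

Lemma null_integral_sq (u : XR -> R) : mu setT = 0%E ->
  measurable_fun setT u -> (\int[m]_z (u z ^+ 2)%:E)%E = 0%E.
Proof.
move=> mu0 mu_u; apply/eqP; rewrite eq_le integral_ge0 ?andbT; last first.
  by move=> z _; rewrite lee_fin sqr_ge0.
apply: (@le_trans _ _ (\int[m]_z +oo)%E).
  apply: ge0_le_integral => //.
  - by move=> z _; rewrite lee_fin sqr_ge0.
  - exact: measurable_sqE.
  - by move=> z _; rewrite leey.
rewrite integral_cst//= (_ : m setT = 0%E) ?mule0//.
apply/eqP; rewrite eq_le measure_ge0 andbT.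
apply: (@le_trans _ _ (\int[mu]_x +oo)%E).
  apply: ge0_le_integral => //.
    exact: measurable_fun_xsection.
  by move=> z _; rewrite leey.
by rewrite integral_cst//= mu0 mule0.
Qed.

(** The convention 0^-1 = 0 annihilates the average over a null ball. *)
Lemma Q_V0 f x r : V x r = 0 -> Q f x r = 0%E.
Proof.
by move=> V0; rewrite /Q V0 invr0 mul0e poweR0r ?mule0// invr_neq0.
Qed.

Definition Qr f x r : R := ball_weight x r * wnrm mu (tnt x r) f.

Lemma QE f x r : (sqint mu (tnt x r) f < +oo)%E -> Q f x r = (Qr f x r)%:E.
Proof.
move=> fin; rewrite /Q /Qr /ball_weight /wnrm.
have s0 := sqint_ge0 mu f (@tent_upper _ _ _ x r).
have sfin : sqint mu (tnt x r) f \is a fin_num by rewrite ge0_fin_numE.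
rewrite -[in LHS](fineK sfin) -EFinM -mulrA.
by rewrite powR12_sqrt ?sqrtrM ?mulr_ge0 ?invr_ge0 ?V_ge0// fine_ge0.
Qed.

Lemma supQ_ge0 f (P : X -> R -> Prop) : (0 <= supQ mu Phi f P)%E.
Proof. by apply: ereal_sup_ubound; left. Qed.

Lemma Q_le_supQ f (P : X -> R -> Prop) x r : 0 < r -> P x r ->
  (Q f x r <= supQ mu Phi f P)%E.
Proof. by move=> r0 Pr; apply: ereal_sup_ubound; right; exists x, r. Qed.

Lemma supQ_le f (P : X -> R -> Prop) (M : \bar R) : (0 <= M)%E ->
  (forall x r, 0 < r -> P x r -> (Q f x r <= M)%E) -> (supQ mu Phi f P <= M)%E.
Proof.
move=> M0 QM; apply: ge_ereal_sup => _ [->//|[x [r [r0 Pr ->]]]].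
exact: QM.
Qed.

(** The essential supremum misses no ball: C_rho f is at least Q(f, B) at every point of B, so if
    Q(f, B) exceeded the norm, B would lie in a null set. *)
Lemma Q_le_norm f x r : 0 < r -> (Q f x r <= Tinf_norm f)%E.
Proof.
move=> r0; have [V0|V0] := eqVneq (V x r) 0.
  by rewrite Q_V0//; exact: Lnorm_ge0.
have Vp : 0 < V x r by rewrite lt_neqAle eq_sym V0 V_ge0.
have muT : (0 < mu setT)%E.
  apply: (@lt_le_trans _ _ (mu (ball x r))); first by rewrite mu_ballE.
  by apply: le_measure => //; rewrite inE//; exact: (ball_measurable mu_borel).
rewrite /Tinf_norm /Defs.Tinf_norm unlock /= muT leNgt; apply/negP => ltQ.
have [A [mA A0 sub]] := ess_sup_ge mu (abse \o C_rho mu Phi f).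
suff : (mu (ball x r) <= 0)%E by rewrite mu_ballE// lee_fin leNgt Vp.
rewrite -A0; apply: le_measure; rewrite ?inE//; first exact: (ball_measurable mu_borel).
move=> y xy; apply: sub => /= h.
have := lt_le_trans ltQ (le_trans (Q_le_supQ f (P := fun x r => ball x r y) r0 xy) (lee_abs _)).
by rewrite ltNge h.
Qed.

Lemma norm_le_Q f (M : \bar R) : (0 <= M)%E ->
  (forall x r, 0 < r -> (Q f x r <= M)%E) -> (Tinf_norm f <= M)%E.
Proof.
move=> M0 QM; rewrite /Tinf_norm /Defs.Tinf_norm unlock /=.
case: ifPn => // _; apply/ess_supP; apply: nearW => y /=.
by rewrite gee0_abs ?supQ_ge0//; apply: supQ_le => // x r r0 _; exact: QM.
Qed.

Lemma Tinf_norm_ge0 f : (0 <= Tinf_norm f)%E.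
Proof. exact: Lnorm_ge0. Qed.

(** Where balls have positive measure, an infinite integral would make Q(f, B) infinite; if mu is
    null, all the integrals vanish. *)
Lemma Tinf_sqint f x r : Tinf f -> 0 < r -> (sqint mu (tnt x r) f < +oo)%E.
Proof.
move=> [mf fy] r0; have [V0|null] := V_gt0_or_null mu_borel mu_doubling.
  have /le_lt_trans/(_ fy) := Q_le_norm f x r0.
  have Vp := V0 x r r0; have rp := rho_gt0 hPhi Vp.
  have s0 := sqint_ge0 mu f (@tent_upper _ _ _ x r).
  rewrite /Q /Defs.Q; case: (sqint _ _ _) s0 => [s _ _||//]; first exact: ltry.
  by rewrite gt0_muley ?lte_fin ?invr_gt0// poweRyr ?invr_neq0// gt0_muley ?lte_fin ?invr_gt0.
rewrite sqintE//; [|exact: (tent_measurable mu_borel)|exact: tent_upper].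
have mt := tent_measurable mu_borel x r; have tu := @tent_upper _ _ _ x r.
by rewrite !null_integral_sq ?adde0 ?ltry//; apply: measurable_weighted => //; case: mf.
Qed.

Definition Tinf_nrm f : R := fine (Tinf_norm f).

Lemma Tinf_normE f : Tinf f -> Tinf_norm f = (Tinf_nrm f)%:E.
Proof. by move=> [_ fy]; rewrite /Tinf_nrm fineK// ge0_fin_numE// Tinf_norm_ge0. Qed.

Lemma Tinf_nrm_ge0 f : 0 <= Tinf_nrm f. Proof. by rewrite fine_ge0// Tinf_norm_ge0. Qed.

Lemma Qr_le_nrm f x r : Tinf f -> 0 < r -> Qr f x r <= Tinf_nrm f.
Proof.
move=> Tf r0; rewrite -lee_fin -Tinf_normE// -QE; first exact: Q_le_norm.
exact: Tinf_sqint.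
Qed.

Lemma TinfP f : cmeasurable f ->
  (forall x r, 0 < r -> (sqint mu (tnt x r) f < +oo)%E) ->
  (exists M, forall x r, 0 < r -> Qr f x r <= M) -> Tinf f.
Proof.
move=> mf sf [M qM]; split=> //.
apply: (@le_lt_trans _ _ (Num.max M 0)%:E); last exact: ltry.
apply: norm_le_Q => [|x r r0]; first by rewrite lee_fin le_max lexx orbT.
by rewrite QE ?lee_fin ?le_max ?qM// sf.
Qed.

Definition cnorm1 (c : R[i]) : R := `|complex.Re c| + `|complex.Im c|.

Lemma cnorm1_ge0 c : 0 <= cnorm1 c. Proof. by rewrite addr_ge0. Qed.

Lemma Qr_lin (c : R[i]) f h x r : Tinf f -> Tinf h -> 0 < r ->
  Qr (fun z => c * f z + h z) x r <= 2 * cnorm1 c * Qr f x r + 2 * Qr h x r.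
Proof.
move=> Tf Th r0; have sf := Tinf_sqint x Tf r0; have sh := Tinf_sqint x Th r0.
have [mf _] := Tf; have [mh _] := Th.
have := wnrm_lin (tent_measurable mu_borel x r) (@tent_upper _ _ _ x r) c mf mh sf sh.
move=> /(ler_wpM2l (ball_weight_ge0 x r)) /le_trans; apply.
by rewrite /Qr /cnorm1 mulrDr (mulrCA (ball_weight x r) (2 * _)) (mulrCA (ball_weight x r) 2).
Qed.

Lemma Tinf_lin (c : R[i]) f h : Tinf f -> Tinf h -> Tinf (fun z => c * f z + h z).
Proof.
move=> Tf Th; have [mf _] := Tf; have [mh _] := Th.
apply: TinfP; first exact: cmeasurable_lin.
  move=> x r r0; apply: sqint_lin => //; try exact: Tinf_sqint.
    exact: (tent_measurable mu_borel).
  exact: tent_upper.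
exists (2 * cnorm1 c * Tinf_nrm f + 2 * Tinf_nrm h) => x r r0; apply: le_trans (Qr_lin c x Tf Th r0) _.
by rewrite lerD// ler_wpM2l ?mulr_ge0 ?cnorm1_ge0 ?Qr_le_nrm.
Qed.

Lemma cmeasurable0 : cmeasurable (fun _ : XR => 0 : R[i]).
Proof. by split; exact: measurable_cst. Qed.

Lemma sqint0 (D : set XR) : sqint mu D (fun=> 0) = 0%E.
Proof.
rewrite /sqint; under eq_integral do
  rewrite ComplexField.Normc.normc0 expr0n/= mul0r.
by rewrite integral0.
Qed.

Lemma Q0 x r : Q (fun=> 0) x r = 0%E.
Proof.
rewrite QE; last by rewrite sqint0 ltry.
by rewrite /Qr /wnrm sqint0 sqrtr0 mulr0.
Qed.

Lemma Tinf0 : Tinf (fun=> 0).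
Proof.
split; first exact: cmeasurable0.
by apply: (@le_lt_trans _ _ 0%E); rewrite ?ltry//; apply: norm_le_Q => // x r _; rewrite Q0.
Qed.

Lemma Tinf_v0 : Tinf_v (fun=> 0).
Proof.
have s0 (F : set_system R) (FF : Filter F) (P : R -> X -> R -> Prop) :
    supQ mu Phi (fun=> 0) (P t) @[t --> F] --> 0%E.
  rewrite (_ : (fun t => _) = cst 0%E); first exact: cvg_cst.
  apply/funext => t; apply/eqP; rewrite eq_le supQ_ge0 andbT.
  by apply: supQ_le => // x r _ _; rewrite Q0.
by split; [exact: Tinf0|exact: s0..].
Qed.

Lemma ge0_cvge0P (T : Type) (F : set_system T) (FF : Filter F) (u : T -> \bar R) :
  (forall t, (0 <= u t)%E) ->
  (u @ F --> 0%E) <-> (forall e : R, 0 < e -> \forall t \near F, (u t <= e%:E)%E).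
Proof.
move=> u0; split=> [/fine_cvgP[ufin /cvgrPdist_le uF] e e0|uF].
  have := uF e e0; apply: filterS2 ufin => t tfin.
  by rewrite sub0r normrN ger0_norm ?fine_ge0//= -lee_fin fineK.
apply/fine_cvgP; split.
  apply: filterS (uF 1 ltr01) => t ut; rewrite ge0_fin_numE//.
  by apply: le_lt_trans ut _; exact: ltry.
apply/cvgrPdist_le => e e0; apply: filterS (uF e e0) => t ut.
rewrite sub0r normrN ger0_norm ?fine_ge0//= -lee_fin fineK// ge0_fin_numE//.
by apply: le_lt_trans ut _; exact: ltry.
Qed.

(** The filter and the condition on balls are left abstract, so that all three vanishing conditions
    are instances. *)
Lemma supQ_lin_cvg (F : set_system R) (FF : Filter F) (P : R -> X -> R -> Prop)
    (c : R[i]) f h : Tinf f -> Tinf h ->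
  supQ mu Phi f (P t) @[t --> F] --> 0%E -> supQ mu Phi h (P t) @[t --> F] --> 0%E ->
  supQ mu Phi (fun z => c * f z + h z)%R (P t) @[t --> F] --> 0%E.
Proof.
move=> Tf Th /ge0_cvge0P-/(_ (fun t => supQ_ge0 f (P t))) ff.
move=> /ge0_cvge0P-/(_ (fun t => supQ_ge0 h (P t))) fh.
apply/ge0_cvge0P => [t|e e0]; first exact: supQ_ge0.
pose K := 2 * cnorm1 c + 2.
have K0 : 0 < K by rewrite ltr_wpDl ?mulr_ge0 ?cnorm1_ge0.
have eK : 0 < e / K by rewrite divr_gt0.
apply: filterS2 (ff _ eK) (fh _ eK) => t tf th.
have ql g x r : Tinf g -> (supQ mu Phi g (P t) <= (e / K)%:E)%E -> 0 < r ->
    P t x r -> Qr g x r <= e / K.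
  move=> Tg tg r0 Pr; rewrite -lee_fin -QE; last exact: Tinf_sqint.
  exact: le_trans (Q_le_supQ g r0 Pr) tg.
apply: supQ_le => [|x r r0 Pr]; first by rewrite lee_fin ltW.
rewrite QE; last by apply: Tinf_sqint => //; exact: Tinf_lin.
rewrite lee_fin; apply: le_trans (Qr_lin c x Tf Th r0) _.
apply: (@le_trans _ _ (2 * cnorm1 c * (e / K) + 2 * (e / K))).
  by rewrite lerD// ler_wpM2l ?mulr_ge0 ?cnorm1_ge0 ?ql.
by rewrite -mulrDl -/K mulrC divfK// gt_eqF.
Qed.

Lemma Tinf_v_lin (c : R[i]) f h : Tinf_v f -> Tinf_v h ->
  Tinf_v (fun z => c * f z + h z).
Proof.
move=> [Tf f1 f2 f3] [Th h1 h2 h3]; split; first exact: Tinf_lin.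
- exact: (@supQ_lin_cvg _ _ (fun c _ r => r <= c)).
- exact: (@supQ_lin_cvg _ _ (fun c _ r => c <= r)).
- exact: (@supQ_lin_cvg _ _ (fun c x r => ball x r `<=` ~` ball x0 c)).
Qed.

Lemma Tinf_normZ (c : R) f : 0 <= c -> Tinf f ->
  (Tinf_norm (fun z => Complex c 0 * f z)%R <= (c * Tinf_nrm f)%:E)%E.
Proof.
move=> c0 Tf; have [mf _] := Tf.
apply: norm_le_Q => [|x r r0]; first by rewrite lee_fin mulr_ge0 ?Tinf_nrm_ge0.
have sf := Tinf_sqint x Tf r0.
have e := sqintZ (tent_measurable mu_borel x r) (@tent_upper _ _ _ x r) c mf sf.
have s0 := sqint_ge0 mu f (@tent_upper _ _ _ x r).
have sfin : sqint mu (tnt x r) f \is a fin_num by rewrite ge0_fin_numE.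
rewrite QE; last by rewrite e -(fineK sfin) -EFinM ltry.
rewrite lee_fin /Qr /wnrm e fineM//= sqrtrM ?sqr_ge0// sqrtr_sqr ger0_norm//.
by rewrite mulrCA ler_wpM2l//; exact: Qr_le_nrm.
Qed.

End TinfSpaces.

(** * Atomic series as functionals *)

Section AtomicSeries.
Context {d : measure_display} {R : realType} {X : measurableMetricType d R}.
Variable mu : {measure set X -> \bar R}.
Hypothesis mu_borel : borel_regular mu.
Hypothesis mu_doubling : doubling mu.
Variables (Phi : R -> R) (hPhi : orlicz_assumption Phi).
Local Notation XR := (X * measurableTypeR R)%type.
Implicit Types (f h : XR -> R[i]) (x y : X) (r s : R).
Local Notation m := (mu \x @lebesgue_measure R)%E.
Local Notation normc := ComplexField.Normc.normc.
Local Notation tnt x r := (tent (ball x r)).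
Local Notation Tinf := (Tinf mu Phi).
Local Notation Tinf_norm := (Tinf_norm mu Phi).
Local Notation Tinf_nrm := (Tinf_nrm mu Phi).

Lemma ReD (u v : R[i]) : complex.Re (u + v) = complex.Re u + complex.Re v.
Proof. by case: u => ? ?; case: v. Qed.

Lemma ImD (u v : R[i]) : complex.Im (u + v) = complex.Im u + complex.Im v.
Proof. by case: u => ? ?; case: v. Qed.

Lemma Re_sum n (t : nat -> R[i]) :
  complex.Re (\sum_(j < n) t j) = \sum_(j < n) complex.Re (t j).
Proof. exact: (big_morph (@complex.Re R) ReD). Qed.

Lemma ReM (u v : R[i]) :
  complex.Re (u * v) = complex.Re u * complex.Re v - complex.Im u * complex.Im v.
Proof. by case: u => ? ?; case: v. Qed.

Lemma ImM (u v : R[i]) :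
  complex.Im (u * v) = complex.Re u * complex.Im v + complex.Im u * complex.Re v.
Proof. by case: u => ? ?; case: v. Qed.

Lemma eq_complexP (u v : R[i]) :
  complex.Re u = complex.Re v -> complex.Im u = complex.Im v -> u = v.
Proof. by case: u => ? ?; case: v => ? ? /= -> ->. Qed.

Lemma normc_ge0 (u : R[i]) : 0 <= normc u.
Proof. by case: u => ? ?; exact: sqrtr_ge0. Qed.

Lemma normr_Re_le (u : R[i]) : `|complex.Re u| <= normc u.
Proof.
rewrite -[leRHS]ger0_norm ?normc_ge0//.
by rewrite -(@ler_pXn2r _ 2) ?nnegrE// !real_normK ?num_real// normc_sqr lerDl sqr_ge0.
Qed.

Lemma normr_Im_le (u : R[i]) : `|complex.Im u| <= normc u.
Proof.
rewrite -[leRHS]ger0_norm ?normc_ge0//.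
by rewrite -(@ler_pXn2r _ 2) ?nnegrE// !real_normK ?num_real// normc_sqr lerDr sqr_ge0.
Qed.

Lemma normc_sum_le n (t : nat -> R[i]) :
  normc (\sum_(j < n) t j) <= \sum_(j < n) normc (t j).
Proof.
elim: n => [|n IH]; first by rewrite !big_ord0 ComplexField.Normc.normc0.
by rewrite !big_ord_recr/=; apply: le_trans (le_normcD _ _) _; rewrite lerD2r.
Qed.

(** * Dual norms on a subspace of the tent space *)

Section Dual.
Variable S : set (XR -> R[i]).
Hypothesis ST : S `<=` Tinf.

Lemma dual_norm_le (l : (XR -> R[i]) -> R[i]) (M : \bar R) :
  (forall f, S f -> Tinf_nrm f <= 1 -> ((normc (l f))%:E <= M)%E) ->
  (dual_norm S Tinf_norm l <= M)%E.
Proof.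
move=> lM; apply: ge_ereal_sup => _ [f [Sf Nf] <-]; apply: lM => //.
by rewrite -lee_fin -Tinf_normE//; exact: ST.
Qed.

Lemma le_dual_norm (l : (XR -> R[i]) -> R[i]) f : S f -> Tinf_nrm f <= 1 ->
  ((normc (l f))%:E <= dual_norm S Tinf_norm l)%E.
Proof.
move=> Sf Nf; apply: ereal_sup_ubound; exists f => //; split=> //.
by rewrite Tinf_normE ?lee_fin//; exact: ST.
Qed.

Hypothesis S0 : S (fun=> 0).

Lemma Tinf_nrm0 : Tinf_nrm (fun=> 0) = 0.
Proof.
apply/le_anti; rewrite Tinf_nrm_ge0 andbT -lee_fin -Tinf_normE; last exact: ST.
by apply: norm_le_Q => // x r _; rewrite Q0.
Qed.

Lemma dual_norm_ge0 (l : (XR -> R[i]) -> R[i]) : (0 <= dual_norm S Tinf_norm l)%E.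
Proof.
apply: (@le_trans _ _ (normc (l (fun=> 0)))%:E); first by rewrite lee_fin normc_ge0.
by apply: le_dual_norm => //; rewrite Tinf_nrm0.
Qed.

Hypothesis S_lin : forall c f h, S f -> S h -> S (fun z => c * f z + h z).

(** As the norm of f may be 0, f is divided by an arbitrary s above its norm, and s then decreases
    to the norm. *)
Lemma dual_norm_bound (l : (XR -> R[i]) -> R[i]) f : in_dual S Tinf_norm l ->
  S f -> normc (l f) <= fine (dual_norm S Tinf_norm l) * Tinf_nrm f.
Proof.
move=> [lin ly] Sf; set D := fine _.
have Dfin : dual_norm S Tinf_norm l \is a fin_num.
  by rewrite ge0_fin_numE// dual_norm_ge0.
have D0 : 0 <= D by rewrite fine_ge0// dual_norm_ge0.
have l0 : l (fun=> 0) = 0.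
  have := lin 1 _ _ S0 S0; rewrite mulr0 addr0 mul1r => /eqP.
  by rewrite -subr_eq0 opprD addNKr oppr_eq0 => /eqP.
have lt s : Tinf_nrm f < s -> normc (l f) <= D * s.
  move=> fs; have s0 : 0 < s := le_lt_trans (Tinf_nrm_ge0 _ _ _) fs.
  pose c : R[i] := Complex s^-1 0.
  have fE : (fun z => c * f z + 0) = (fun z => Complex s^-1 0 * f z).
    by apply/funext => z; rewrite addr0.
  have Sc : S (fun z => c * f z + 0) by exact: S_lin.
  have Nc : Tinf_nrm (fun z => c * f z + 0) <= 1.
    rewrite -lee_fin -Tinf_normE; last exact: ST.
    rewrite fE; apply: le_trans (Tinf_normZ _ _ _ _ _) _ => //.
    - by rewrite invr_ge0 ltW.
    - exact: ST.
    - by rewrite lee_fin mulrC ler_pdivrMr// mul1r ltW.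
  have := le_dual_norm l Sc Nc; rewrite lin// l0 addr0 -(fineK Dfin) lee_fin.
  rewrite ComplexField.Normc.normcM /= expr0n/= addr0 sqrtr_sqr.
  by rewrite ger0_norm ?invr_ge0 ?(ltW s0)// mulrC ler_pdivrMr.
apply/ler_addgt0Pr => e e0.
have D1 : 0 < D + 1 by rewrite ltr_wpDl.
have := lt (Tinf_nrm f + e / (D + 1)); rewrite ltrDl divr_gt0// => /(_ isT) /le_trans.
apply; rewrite mulrDr lerD2l mulrCA ler_piMr ?(ltW e0)//.
by rewrite ler_pdivrMr// mul1r lerDl.
Qed.

End Dual.

Lemma atomP a : atom mu Phi a -> exists x r, [/\ 0 < r,
  cmeasurable a, [set z | upper z /\ a z != 0] `<=` tnt x r,
  (sqint mu (tnt x r) a < +oo)%E & wnrm mu (tnt x r) a <= ball_weight mu Phi x r].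
Proof.
move=> [ma [x [r [r0 sa ia]]]]; exists x, r; split => //.
  by apply: le_lt_trans ia _; exact: ltry.
rewrite /wnrm -[leRHS]ger0_norm ?(ball_weight_ge0 mu hPhi)// -sqrtr_sqr.
rewrite ler_wsqrtr// sqr_ball_weight -lee_fin fineK// ge0_fin_numE.
  by apply: le_lt_trans ia _; exact: ltry.
by apply: sqint_ge0; exact: tent_upper.
Qed.

Lemma pairing_atom_le f a : Tinf f -> atom mu Phi a ->
  normc (pairing mu f a) <= 4 * Tinf_nrm f.
Proof.
move=> Tf /atomP[x [r [r0 ma sa fa na]]]; have [mf _] := Tf.
have mt := tent_measurable mu_borel x r; have tu := @tent_upper _ _ _ x r.
have sf := Tinf_sqint mu_borel mu_doubling hPhi x Tf r0.
apply: le_trans (pairing_le mt tu mf ma sf fa sa) _; rewrite ler_pM2l//.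
apply: le_trans (Qr_le_nrm mu_borel mu_doubling hPhi x Tf r0).
by rewrite /Qr mulrC ler_wpM2r// wnrm_ge0.
Qed.

Lemma pairing_lin c f h a : Tinf f -> Tinf h -> atom mu Phi a ->
  pairing mu (fun z => c * f z + h z) a = c * pairing mu f a + pairing mu h a.
Proof.
move=> Tf Th /atomP[x [r [r0 ma sa fa na]]].
have [mf _] := Tf; have [mh _] := Th.
have mt := tent_measurable mu_borel x r; have tu := @tent_upper _ _ _ x r.
have sf := Tinf_sqint mu_borel mu_doubling hPhi x Tf r0.
have sh := Tinf_sqint mu_borel mu_doubling hPhi x Th r0.
have sc := sqint_lin mt tu c mf mh sf sh.
have [fR fI] := L2_weighted mt tu mf sf.
have [hR hI] := L2_weighted mt tu mh sh.
have [aR aI] := L2_weighted mt tu ma fa.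
rewrite (pairingE mt tu (cmeasurable_lin c mf mh) ma sc fa sa).
rewrite (pairingE mt tu mf ma sf fa sa) (pairingE mt tu mh ma sh fa sa).
rewrite weightedRe_lin weightedIm_lin.
have fRI := L2_lin (- complex.Im c) fI hR.
have fIR := L2_lin (complex.Im c) fR hI.
rewrite !(inner_linl _ fR fRI aR, inner_linl _ fI fIR aI,
  inner_linl _ fR fRI aI, inner_linl _ fI fIR aR, inner_linl _ fI hR aR,
  inner_linl _ fR hI aI, inner_linl _ fI hR aI, inner_linl _ fR hI aR).
by case: c {fRI fIR sc} => u v; apply: eq_complexP => /=; ring.
Qed.

(** * The functional defined by an atomic series *)

Section Series.
Variables (lam : nat -> R[i]) (aj : nat -> XR -> R[i]).
Hypothesis aj_atom : forall j, atom mu Phi (aj j).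
Hypothesis lam_fin : (\sum_(0 <= j <oo) (normc (lam j))%:E < +oo)%E.
Let Lam : R := fine (\sum_(0 <= j <oo) (normc (lam j))%:E)%E.
Let psum f (n : nat) : R[i] := \sum_(j < n) lam j * pairing mu f (aj j).

Let LamE : (\sum_(0 <= j <oo) (normc (lam j))%:E = Lam%:E)%E.
Proof.
rewrite fineK// ge0_fin_numE// nneseries_ge0// => n _ _.
by rewrite lee_fin normc_ge0.
Qed.

Lemma sum_normc_le n : \sum_(j < n) normc (lam j) <= Lam.
Proof.
rewrite -lee_fin -LamE -sumEFin -(big_mkord xpredT (fun j => (normc (lam j))%:E)).
by apply: nneseries_lim_ge => k _ _; rewrite lee_fin normc_ge0.
Qed.

Lemma sum_normc_cvg : \sum_(j < n) normc (lam j) @[n --> \oo] --> Lam.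
Proof.
have : (fun n => \sum_(0 <= j < n) (normc (lam j))%:E)%E @ \oo --> Lam%:E.
  rewrite -LamE; apply: is_cvg_nneseries => n _ _.
  by rewrite lee_fin normc_ge0.
under eq_cvg do rewrite big_mkord sumEFin.
by move/fine_cvg.
Qed.

Lemma normc_term_le f j : Tinf f ->
  normc (lam j * pairing mu f (aj j)) <= 4 * Tinf_nrm f * normc (lam j).
Proof.
move=> Tf; rewrite ComplexField.Normc.normcM mulrC ler_wpM2r ?normc_ge0//.
exact: pairing_atom_le.
Qed.

Lemma psum_le f n : Tinf f -> normc (psum f n) <= 4 * Tinf_nrm f * Lam.
Proof.
move=> Tf; apply: le_trans (normc_sum_le n (fun j => lam j * pairing mu f (aj j))) _.
apply: (@le_trans _ _ (\sum_(j < n) 4 * Tinf_nrm f * normc (lam j))).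
  by apply: ler_sum => j _; exact: normc_term_le.
by rewrite -mulr_sumr ler_wpM2l ?sum_normc_le// mulr_ge0 ?Tinf_nrm_ge0.
Qed.

Lemma psum_lin c f h n : Tinf f -> Tinf h ->
  psum (fun z => c * f z + h z) n = c * psum f n + psum h n.
Proof.
move=> Tf Th; rewrite /psum mulr_sumr -big_split/=; apply: eq_bigr => j _.
by rewrite pairing_lin// mulrDr mulrCA.
Qed.

Lemma atomic_decomposition_le (g : (XR -> R[i]) -> R[i]) f :
  atomic_decomposition mu Phi g lam aj -> Tinf f -> Tinf_nrm f <= 1 ->
  normc (g f) <= 4 * Lam.
Proof.
move=> [_ _ gcvg] Tf Nf; apply/ler_addgt0Pr => e e0.
have TT : Tinf `<=` Tinf by [].
have /ge0_cvge0P := gcvg.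
move=> /(_ (fun n => dual_norm_ge0 TT (Tinf0 mu Phi) _) e e0)[n _ /(_ n (leqnn n))] /= gn.
have := le_trans (le_dual_norm TT _ Tf Nf) gn; rewrite lee_fin => {}gn.
rewrite -[g f](subrK (psum f n)).
apply: le_trans (le_normcD _ _) _; rewrite addrC lerD//.
apply: le_trans (psum_le n Tf) _.
have L0 : 0 <= Lam by apply: le_trans (sum_normc_le 0); rewrite big_ord0.
by rewrite ler_wpM2r// ler_piMr.
Qed.

(** The limits exist for f in [Tinf]; elsewhere the value carries no meaning. *)
Definition atomic_functional f : R[i] :=
  Complex (limn (fun n => complex.Re (psum f n))) (limn (fun n => complex.Im (psum f n))).

Lemma cvg_psum (p : R[i] -> R) f : Tinf f ->
  (forall u v, p (u + v) = p u + p v) -> (forall u, `|p u| <= normc u) ->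
  cvgn (fun n => p (psum f n)).
Proof.
move=> Tf pD pn.
have p0 : p 0 = 0 by have := pD 0 0; rewrite addr0; lra.
have -> : (fun n => p (psum f n)) = series (fun j => p (lam j * pairing mu f (aj j))).
  by apply/funext => n; rewrite /psum /series/= big_mkord (big_morph p pD p0).
apply: normed_cvg; apply: nondecreasing_is_cvgn.
  by apply: nondecreasing_series => n _ _; exact: normr_ge0.
exists (4 * Tinf_nrm f * Lam) => _ [n _ <-]; rewrite /= /series/= big_mkord.
apply: (@le_trans _ _ (\sum_(j < n) 4 * Tinf_nrm f * normc (lam j))).
  by apply: ler_sum => j _; apply: le_trans (pn _) (normc_term_le _ Tf).
by rewrite -mulr_sumr ler_wpM2l ?sum_normc_le// mulr_ge0 ?Tinf_nrm_ge0.
Qed.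

Lemma atomic_functional_cvg f : Tinf f ->
  complex.Re (psum f n) @[n --> \oo] --> complex.Re (atomic_functional f) /\
  complex.Im (psum f n) @[n --> \oo] --> complex.Im (atomic_functional f).
Proof.
by move=> Tf; split; apply: cvg_psum => //; [exact: ReD|exact: normr_Re_le|
  exact: ImD|exact: normr_Im_le].
Qed.

Lemma psum_sub_le f n i : Tinf f ->
  normc (psum f (n + i) - psum f n) <=
  4 * Tinf_nrm f * (\sum_(j < n + i) normc (lam j) - \sum_(j < n) normc (lam j)).
Proof.
move=> Tf; elim: i => [|i IH].
  by rewrite addn0 !subrr ComplexField.Normc.normc0 mulr0.
rewrite addnS /psum !big_ord_recr/= addrAC.
apply: le_trans (le_normcD _ _) _.
apply: le_trans (lerD IH (normc_term_le (n + i) Tf)) _.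
by rewrite -mulrDr addrAC.
Qed.

Lemma limn_sub_le (u : R^nat) (K : R) n : cvgn u ->
  (forall i, `|u (n + i)%N - u n| <= K) -> `|limn u - u n| <= K.
Proof.
move=> cu uK; rewrite ler_distl.
apply/andP; split.
  apply: limr_ge => //; exists n => // k /= nk.
  by have := uK (k - n)%N; rewrite subnKC// ler_distl => /andP[].
apply: limr_le => //; exists n => // k /= nk.
by have := uK (k - n)%N; rewrite subnKC// ler_distl => /andP[].
Qed.

(** The error is the tail of the coefficients, uniformly on the unit ball, which gives convergence
    in the dual norm. The factor 8 is 4 for each of the real and imaginary parts. *)
Lemma atomic_functional_sub_le f n : Tinf f ->
  normc (atomic_functional f - psum f n) <=
  8 * Tinf_nrm f * (Lam - \sum_(j < n) normc (lam j)).
Proof.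
move=> Tf; pose K := 4 * Tinf_nrm f * (Lam - \sum_(j < n) normc (lam j)).
have bnd i : normc (psum f (n + i) - psum f n) <= K.
  apply: le_trans (psum_sub_le n i Tf) _.
  by rewrite ler_wpM2l ?mulr_ge0 ?Tinf_nrm_ge0// lerD2r sum_normc_le.
have ReB (u v : R[i]) : complex.Re (u - v) = complex.Re u - complex.Re v.
  by case: u => ? ?; case: v.
have ImB (u v : R[i]) : complex.Im (u - v) = complex.Im u - complex.Im v.
  by case: u => ? ?; case: v.
apply: le_trans (normc_le_ReIm _) _; rewrite ReB ImB.
have -> : 8 * Tinf_nrm f * (Lam - \sum_(j < n) normc (lam j)) = K + K by rewrite /K; ring.
apply: lerD; apply: limn_sub_le => [|i].
- by apply: cvg_psum => //; [exact: ReD|exact: normr_Re_le].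
- by rewrite -ReB; apply: le_trans (normr_Re_le _) (bnd i).
- by apply: cvg_psum => //; [exact: ImD|exact: normr_Im_le].
- by rewrite -ImB; apply: le_trans (normr_Im_le _) (bnd i).
Qed.

Lemma atomic_functional_linear : linear_on Tinf atomic_functional.
Proof.
move=> c f h Tf Th.
have [fR fI] := atomic_functional_cvg Tf.
have [hR hI] := atomic_functional_cvg Th.
have [gR gI] := atomic_functional_cvg (Tinf_lin mu_borel mu_doubling hPhi c Tf Th).
apply: eq_complexP; rewrite (ReD, ImD) (ReM, ImM).
- apply: (cvg_unique _ gR) => //.
  have -> : (fun n => complex.Re (psum (fun z => c * f z + h z) n)) = (fun n =>
      complex.Re c * complex.Re (psum f n) - complex.Im c * complex.Im (psum f n) +
      complex.Re (psum h n)).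
    by apply/funext => n; rewrite psum_lin// ReD ReM.
  exact: cvgD (cvgB (cvgM (cvg_cst _) fR) (cvgM (cvg_cst _) fI)) hR.
- apply: (cvg_unique _ gI) => //.
  have -> : (fun n => complex.Im (psum (fun z => c * f z + h z) n)) = (fun n =>
      complex.Re c * complex.Im (psum f n) + complex.Im c * complex.Re (psum f n) +
      complex.Im (psum h n)).
    by apply/funext => n; rewrite psum_lin// ImD ImM.
  exact: cvgD (cvgD (cvgM (cvg_cst _) fI) (cvgM (cvg_cst _) fR)) hI.
Qed.

Lemma atomic_functional_decomposition :
  atomic_decomposition mu Phi atomic_functional lam aj.
Proof.
split=> //; have TT : Tinf `<=` Tinf by [].
apply/ge0_cvge0P => [n|e e0].
  exact: (dual_norm_ge0 TT (Tinf0 mu Phi)).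
have e8 : 0 < e / 8 by rewrite divr_gt0.
have /cvgrPdist_le/(_ _ e8) := sum_normc_cvg.
apply: filterS => n ne; apply: (dual_norm_le TT) => f Tf Nf.
rewrite lee_fin; apply: le_trans (atomic_functional_sub_le n Tf) _.
have t0 : 0 <= Lam - \sum_(j < n) normc (lam j) by rewrite subr_ge0 sum_normc_le.
rewrite ger0_norm// in ne.
by have := Tinf_nrm_ge0 mu Phi f; nra.
Qed.

Lemma atomic_functional_Ttilde : Ttilde mu Phi atomic_functional.
Proof.
have dec := atomic_functional_decomposition.
split; last by exists lam, aj.
split; first exact: atomic_functional_linear.
apply: (@le_lt_trans _ _ (4 * Lam)%:E); last exact: ltry.
have TT : Tinf `<=` Tinf by [].
apply: (dual_norm_le TT) => f Tf Nf.
by rewrite lee_fin; exact: atomic_decomposition_le.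
Qed.

End Series.
End AtomicSeries.

(** * Representing functionals on the vanishing tent space *)

Section Converse.
Context {d : measure_display} {R : realType} {X : measurableMetricType d R}.
Variable mu : {measure set X -> \bar R}.
Hypothesis mu_borel : borel_regular mu.
Hypothesis mu_doubling : doubling mu.
Variables (Phi : R -> R) (hPhi : orlicz_assumption Phi) (x0 : X).
Local Notation XR := (X * measurableTypeR R)%type.
Implicit Types (f : XR -> R[i]) (h : XR -> R) (x y : X) (r s : R).
Local Notation m := (mu \x @lebesgue_measure R)%E.
Local Notation V := (V mu).
Local Notation normc := ComplexField.Normc.normc.
Local Notation tnt x r := (tent (ball x r)).
Local Notation Tinf := (Tinf mu Phi).
Local Notation Tinf_norm := (Tinf_norm mu Phi).
Local Notation Tinf_v := (Tinf_v mu Phi x0).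
Local Notation Tinf_nrm := (Tinf_nrm mu Phi).
Local Notation Qr := (Qr mu Phi).
Local Notation ball_weight := (ball_weight mu Phi).

Lemma Tinf_v_Tinf : Tinf_v `<=` Tinf. Proof. by move=> f []. Qed.

Lemma le_sqint (D D' : set XR) f : measurable D -> measurable D' ->
  D' `<=` upper -> D `<=` D' -> cmeasurable f -> (sqint mu D f <= sqint mu D' f)%E.
Proof.
move=> mD mD' D'u DD' mf; have Du := subset_trans DD' D'u; have [mR mI] := mf.
rewrite !sqintE//; apply: leeD; apply: ge0_le_integral => //.
1,5: by move=> z _; rewrite lee_fin sqr_ge0.
1,2,4,5: by apply: measurable_sqE; exact: measurable_weighted.
all: move=> z _; rewrite lee_fin !weightedE; case: ifPn => [|_];
  [by rewrite !inE => /DD'; rewrite -in_setE => ->|by rewrite expr0n/= sqr_ge0].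
Qed.

(** Tents grow with the ball, so only the weights need comparing: [rhoV_le] costs K2, and the square
    root of the ratio of measures is estimated crudely by K. *)
Lemma Qr_comparable (K : R) : 1 <= K -> exists2 K', 0 <= K' &
  forall f x r y s, Tinf f -> 0 < r -> 0 < s -> 0 < V x r ->
    ball x r `<=` ball y s -> V y s <= K * V x r -> Qr f x r <= K' * Qr f y s.
Proof.
move=> K1; have [K2 K21 rhoK] := rhoV_le hPhi K1.
have K0 : 0 < K by exact: lt_le_trans K1.
have K20 : 0 < K2 by exact: lt_le_trans K21.
exists (K2 * K); first by rewrite mulr_ge0 ?ltW.
move=> f x r y s Tf r0 s0 Vx xy VK.
have Vxy : V x r <= V y s by exact: le_V.
have Vy : 0 < V y s := lt_le_trans Vx Vxy.
have wle : ball_weight x r <= K2 * K * ball_weight y s.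
  rewrite /ball_weight mulrACA; apply: ler_pM.
  - by rewrite invr_ge0 ltW// rho_gt0.
  - exact: sqrtr_ge0.
  - exact: rhoK.
  - apply: (@le_trans _ _ (Num.sqrt (K ^+ 2 * (V y s)^-1))); last first.
      by rewrite sqrtrM ?sqr_ge0// sqrtr_sqr ger0_norm// ltW.
    rewrite ler_wsqrtr// ler_pdivlMr// mulrC ler_pdivrMr//.
    by apply: le_trans VK _; rewrite ler_pM2r// expr2 ler_pMl.
have [mf _] := Tf.
have fin := Tinf_sqint mu_borel mu_doubling hPhi y Tf s0.
have sle : (sqint mu (tnt x r) f <= sqint mu (tnt y s) f)%E.
  apply: le_sqint => //; try exact: (tent_measurable mu_borel).
    exact: tent_upper.
  exact: subset_tent.
rewrite /Qr mulrA; apply: ler_pM => //.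
- exact: ball_weight_ge0.
- exact: wnrm_ge0.
- rewrite ler_wsqrtr// fine_le// ge0_fin_numE//; last 2 first.
  + by apply: sqint_ge0; exact: tent_upper.
  + by apply: sqint_ge0; exact: tent_upper.
  + exact: le_lt_trans fin.
Qed.

(** Each of the three ways in which a ball can be far out in the family is covered by one of the
    vanishing conditions. *)
Lemma Tinf_v_tail (B : nat -> option (X * R)) :
  (forall j y s, B j = Some (y, s) -> 0 < s) ->
  (forall c, 0 < c -> exists n, forall j y s, (n <= j)%N -> B j = Some (y, s) ->
      [\/ s < c^-1, c < s | c < mdist x0 y]) ->
  forall f, Tinf_v f -> forall e, 0 < e ->
    exists n, forall j y s, (n <= j)%N -> B j = Some (y, s) -> Qr f y s <= e.
Proof.
move=> B0 Bn f [Tf f1 f2 f3] e e0.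
have ge0 P := @supQ_ge0 _ _ _ mu Phi f P.
have qe (P : X -> R -> Prop) y s : (supQ mu Phi f P <= e%:E)%E -> 0 < s -> P y s ->
    Qr f y s <= e.
  move=> fe s0 Ps; rewrite -lee_fin -QE//; last exact: (Tinf_sqint mu_borel mu_doubling hPhi).
  exact: le_trans (Q_le_supQ mu Phi f s0 Ps) fe.
move/ge0_cvge0P : f1 => /(_ (fun c => ge0 _) e e0)[c1 /= c10 f1].
move/ge0_cvge0P : f2 => /(_ (fun c => ge0 _) e e0)[c2 [c2r f2]].
move/ge0_cvge0P : f3 => /(_ (fun c => ge0 _) e e0)[c3 [c3r f3]].
(* A single c that meets the thresholds of the three conditions together. *)
pose c := 2 / c1 + (`|c2| + 1) + (`|c3| + 1).
have c1i : 0 < 2 / c1 by rewrite divr_gt0.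
have a2 := normr_ge0 c2; have a3 := normr_ge0 c3.
have c0 : 0 < c by rewrite /c; lra.
have [n nP] := Bn c c0.
exists n => j y s nj Bj; have s0 := B0 _ _ _ Bj.
have := nP j y s nj Bj.
have l2 := ler_norm c2; have l3 := ler_norm c3.
have big (t : R) : `|c2| + 1 <= t -> (supQ mu Phi f (fun _ r => (t <= r)%R) <= e%:E)%E.
  by move=> t2; apply: f2; lra.
(* Large radii are dealt with before the alternatives: afterwards s < |c2| + 1, so a centre farther
   than c from x0 keeps the whole ball away from B(x0, |c3| + 1). *)
have [sb|sb] := leP (`|c2| + 1) s.
  by move=> _; apply: qe (big _ (lexx _)) s0 sb.
case=> [sc|cs|cy].
- have cc1 : c^-1 <= c1 / 2.
    by rewrite -[leRHS]invrK invf_div lef_pV2 ?posrE// /c; lra.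
  have h1 : (supQ mu Phi f (fun _ r => (r <= c1 / 2)%R) <= e%:E)%E.
    apply: f1; last by rewrite divr_gt0.
    by rewrite /= sub0r normrN gtr0_norm ?divr_gt0//; lra.
  by apply: qe h1 s0 _; exact: le_trans (ltW sc) cc1.
- by exfalso; move: cs sb; rewrite /c; lra.
- have c3lt : c3 < `|c3| + 1 by lra.
  apply: qe (f3 _ c3lt) s0 _.
  move=> z; rewrite in_ball => yz; rewrite /setC /= in_ball => x0z.
  have := metric_triangle x0 z y; rewrite (metric_sym z y).
  by move: cy; rewrite /c; lra.
Qed.

(** * Real components over a ball and atoms with real amplitude *)

Definition part (b : bool) : R[i] -> R := if b then @complex.Im R else @complex.Re R.

Definition ball_component y s b f : XR -> R :=
  fun z => ball_weight y s * weighted (tnt y s) (part b) f z.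

Lemma L2_part y s b f : Tinf f -> 0 < s -> L2 m (weighted (tnt y s) (part b) f).
Proof.
move=> Tf s0; have [mf _] := Tf.
have [LR LI] := L2_weighted (tent_measurable mu_borel y s) (@tent_upper _ _ _ y s)
  mf (Tinf_sqint mu_borel mu_doubling hPhi y Tf s0).
by rewrite /part; case: b.
Qed.

Lemma nrm_ball_component y s b f : Tinf f -> 0 < s ->
  nrm m (ball_component y s b f) <= Qr f y s.
Proof.
move=> Tf s0; rewrite nrmZ; last exact: L2_part.
rewrite ger0_norm ?ball_weight_ge0// ler_wpM2l ?ball_weight_ge0//.
have [mf _] := Tf.
have [] := nrm_le_wnrm (tent_measurable mu_borel y s) (@tent_upper _ _ _ y s)
  mf (Tinf_sqint mu_borel mu_doubling hPhi y Tf s0).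
by rewrite /part; case: b.
Qed.

Lemma Qr_le_components y s f : Tinf f -> 0 < s ->
  Qr f y s <= nrm m (ball_component y s false f) + nrm m (ball_component y s true f).
Proof.
move=> Tf s0; rewrite !nrmZ; [|exact: L2_part..].
rewrite ger0_norm ?ball_weight_ge0// -mulrDr ler_wpM2l ?ball_weight_ge0//.
have [mf _] := Tf.
exact: (wnrm_le (tent_measurable mu_borel y s) (@tent_upper _ _ _ y s)
  mf (Tinf_sqint mu_borel mu_doubling hPhi y Tf s0)).
Qed.

Lemma ball_component_lin y s b (c : R) f f' :
  ball_component y s b (fun z => Complex c 0 * f z + f' z) =
  fun z => c * ball_component y s b f z + ball_component y s b f' z.
Proof.
apply/funext => z; rewrite /ball_component /part.
by case: b; rewrite (weightedRe_lin, weightedIm_lin) /=; ring.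
Qed.

Lemma ball_component0 y s b : ball_component y s b (fun=> 0) = fun=> 0.
Proof.
apply/funext => z; rewrite /ball_component weightedE /part.
by case: b; rewrite /= mul0r if_same mulr0.
Qed.

(* The phase [-i] makes [Re (f * a) = t * Im f], so that atoms with real
   amplitude [t] see both parts of [f]. *)
Definition pre_atom y s b (c : R) h : XR -> R[i] := fun z =>
  if z \in tnt y s then
    let t := c * h z * z.2 `^ 2^-1 in if b then Complex 0 (- t) else Complex t 0
  else 0.

Section PreAtom.
Variables (y : X) (s : R) (s0 : 0 < s) (b : bool) (c : R) (h : XR -> R).
Hypothesis Lh : L2 m h.
Let D : set XR := tnt y s.
Let mD : measurable D. Proof. exact: (tent_measurable mu_borel). Qed.
Let Du : D `<=` upper. Proof. exact: tent_upper. Qed.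
Let a := pre_atom y s b c h.
Let hD : XR -> R := h \_ D.

(** A Riesz representative lives on the whole product, while an atom must be supported in the tent.
    Cutting it down does not increase its norm, nor does it change its inner product with functions
    vanishing off the tent. *)
Lemma L2_restrict : L2 m hD.
Proof.
have [mh ih] := Lh; apply: (@le_integral_sq _ _ _ m _ (fun z => (h z ^+ 2)%:E)) => //.
- by apply/(measurable_restrictT _ mD); apply: measurable_funTS.
- exact: measurable_sqE.
- move=> z; rewrite lee_fin /hD patchE; case: ifP => // _.
  by rewrite expr0n/= sqr_ge0.
Qed.

Lemma nrm_restrict_le : nrm m hD <= nrm m h.
Proof.
rewrite -(@ler_pXn2r _ 2) ?nnegrE ?nrm_ge0// -lee_fin -!integral_sqE//; last first.
  exact: L2_restrict.
apply: ge0_le_integral => //.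
- by move=> z _; rewrite lee_fin sqr_ge0.
- by apply: measurable_sqE; case: L2_restrict.
- by apply: measurable_sqE; case: Lh.
- move=> z _; rewrite lee_fin /hD patchE; case: ifP => // _.
  by rewrite expr0n/= sqr_ge0.
Qed.

(** The factor t^(1/2) of [pre_atom] cancels the weight t^(-1/2), and the sign is that of the phase
    -i. *)
Lemma weighted_pre_atom (b' : bool) :
  weighted D (part b') a = fun z => if b' == b then (-1) ^+ b * (c * hD z) else 0.
Proof.
apply/funext => z; rewrite weightedE /a /pre_atom /hD patchE /D.
have [Dz|_] := boolP (z \in tnt y s); last by rewrite !mulr0 if_same.
rewrite inE in Dz; have z0 : 0 < z.2 by exact/upper_gt0/Du.
have e : z.2 `^ 2^-1 * z.2 `^ (- 2^-1) = 1.
  by rewrite powRN mulfV// gt_eqF// powR_gt0.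
have e' : c * h z * z.2 `^ 2^-1 * z.2 `^ (- 2^-1) = c * h z.
  by rewrite -mulrA e mulr1.
by rewrite /part; case: b' (b) => -[]; rewrite /= ?mul0r// ?mulNr ?e' ?expr1 ?expr0
  ?mul1r ?mulN1r.
Qed.

Lemma cmeasurable_pre_atom : cmeasurable a.
Proof.
have [mh _] := Lh.
have mt : measurable_fun setT ((fun z : XR => c * h z * z.2 `^ 2^-1) \_ D).
  apply/(measurable_restrictT _ mD); apply: measurable_funM; last exact: measurable_weight.
  by apply: measurable_funTS; apply: measurable_funM => //; exact: measurable_cst.
have E : (fun z => complex.Re (a z)) =
      (if b then (fun=> 0) else (fun z : XR => c * h z * z.2 `^ 2^-1) \_ D) /\
    (fun z => complex.Im (a z)) =
      (if b then (fun z => - ((fun z : XR => c * h z * z.2 `^ 2^-1) \_ D) z) else fun=> 0).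
  rewrite /a /pre_atom; split; apply/funext => z; case: (b);
    rewrite ?patchE -/D; case: ifP => //= _; by rewrite oppr0.
rewrite /cmeasurable; case: E => -> ->; case: (b); split; try exact: measurable_cst.
  by apply: measurable_funTS; exact: measurableT_comp mt.
exact: measurable_funTS.
Qed.

Lemma sqint_pre_atom : (sqint mu D a <= (c ^+ 2 * nrm m h ^+ 2)%:E)%E.
Proof.
rewrite (sqintE mu mD Du cmeasurable_pre_atom).
have -> : weighted D (@complex.Re R) a = _ := weighted_pre_atom false.
have -> : weighted D (@complex.Im R) a = _ := weighted_pre_atom true.
have LD := L2_restrict.
have eq0 : (\int[m]_z ((0 : R) ^+ 2)%:E = 0)%E.
  by rewrite expr0n/= integral0.
have main : (\int[m]_z (((-1) ^+ b * (c * hD z)) ^+ 2)%:E <= (c ^+ 2 * nrm m h ^+ 2)%:E)%E.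
  rewrite integral_sqE; last by apply: L2Z; exact: L2Z.
  rewrite nrmZ ?nrmZ//; last exact: L2Z.
  rewrite normrX normrN1 expr1n mul1r exprMn real_normK ?num_real// lee_fin.
  rewrite ler_wpM2l ?sqr_ge0//.
  by rewrite ler_pXn2r ?nnegrE ?nrm_ge0// nrm_restrict_le.
by case: b main => /= main; rewrite eq0 ?add0e ?adde0.
Qed.

(** In Re (f a) = Re f Re a - Im f Im a, the minus sign cancels that of the phase when [b] is true,
    so both cases give one formula. *)
Lemma Re_pairing_pre_atom f : Tinf f ->
  complex.Re (pairing mu f a) = c * inner m (weighted D (part b) f) h.
Proof.
move=> Tf; have [mf _] := Tf.
have fin := Tinf_sqint mu_borel mu_doubling hPhi y Tf s0.
have afin : (sqint mu D a < +oo)%E by apply: le_lt_trans sqint_pre_atom _; exact: ltry.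
have supp : [set z | upper z /\ a z != 0] `<=` D.
  move=> z [_]; rewrite /a /pre_atom -/D; case: ifPn => [|_]; first by rewrite inE.
  by rewrite eqxx.
rewrite (pairingE mD Du mf cmeasurable_pre_atom fin afin supp) /=.
have LD := L2_restrict.
have restr p : inner m (weighted D p f) hD = inner m (weighted D p f) h.
  apply: eq_Rintegral => z _; rewrite weightedE /hD patchE.
  by case: ifP => //; rewrite !mul0r.
have -> : weighted D (@complex.Re R) a = _ := weighted_pre_atom false.
have -> : weighted D (@complex.Im R) a = _ := weighted_pre_atom true.
have i0 u : inner m u (fun=> 0) = 0 by rewrite innerC inner0l.
have L2p b' := L2_part y b' Tf s0.
have LcD : L2 m (fun z => c * hD z) by exact: L2Z.
have hb : inner m (weighted D (part b) f) (fun z => (-1) ^+ b * (c * hD z)) =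
    (-1) ^+ b * (c * inner m (weighted D (part b) f) h).
  by rewrite innerZr// innerZr// restr.
by case: b hb => /= hb; rewrite i0 hb ?expr0 ?expr1 ?mul1r ?mulN1r ?sub0r ?subr0 ?opprK.
Qed.

End PreAtom.
End Converse.

(** * The atomic series of a bounded functional *)

Section Dual.
Context {d : measure_display} {R : realType} {X : measurableMetricType d R}.
Variable mu : {measure set X -> \bar R}.
Hypothesis mu_borel : borel_regular mu.
Hypothesis mu_doubling : doubling mu.
Variables (Phi : R -> R) (hPhi : orlicz_assumption Phi) (x0 : X).
Local Notation XR := (X * measurableTypeR R)%type.
Local Notation m := (mu \x @lebesgue_measure R)%E.
Local Notation normc := ComplexField.Normc.normc.
Local Notation Tinf := (Tinf mu Phi).
Local Notation Tinf_norm := (Tinf_norm mu Phi).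
Local Notation Tinf_v := (Tinf_v mu Phi x0).

(** The factor 2 K' bounds the norm of f by the supremum of its coordinates: K' from passing to a
    ball of the family, 2 from splitting f into real and imaginary part. The added 1 makes the
    constant positive. *)
Lemma Tinf_v_dual_series : exists2 C : R, 0 < C &
  forall l, in_dual Tinf_v Tinf_norm l ->
  exists (lam : nat -> R[i]) (aj : nat -> XR -> R[i]), [/\
    forall j, atom mu Phi (aj j),
    forall n, \sum_(j < n) normc (lam j) <= C * fine (dual_norm Tinf_v Tinf_norm l) &
    forall f, Tinf_v f -> \sum_(j < n) complex.Re (lam j * pairing mu f (aj j))
      @[n --> \oo] --> complex.Re (l f)].
Proof.
have [B [K [K1 Bpos Bcov Bfar]]] := doubling_ball_family mu_borel mu_doubling x0.
have [K' K'0 qK] := Qr_comparable mu_borel mu_doubling hPhi K1.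
have TvT := @Tinf_v_Tinf _ _ _ mu Phi x0.
have Tv0 := Tinf_v0 mu Phi x0.
have Tv_lin := Tinf_v_lin mu_borel mu_doubling hPhi (x0 := x0).
exists (2 * K' + 1); first by rewrite ltr_wpDl ?mulr_ge0.
move=> l l_dual; have [l_lin l_fin] := l_dual.
set D := fine _; have D0 : 0 <= D by rewrite fine_ge0// dual_norm_ge0.
have l_le f : Tinf_v f -> normc (l f) <= D * Tinf_nrm mu Phi f.
  by move=> Tf; exact: dual_norm_bound.
have l0 : l (fun=> 0) = 0.
  apply: ComplexField.Normc.eq0_normc; apply/le_anti; rewrite normc_ge0 andbT.
  by apply: le_trans (l_le _ Tv0) _; rewrite (Tinf_nrm0 TvT)// mulr0.
(* Coordinates 2 i and 2 i + 1 carry the real and the imaginary part of f over the i-th ball;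
   indices without a ball carry 0. *)
pose comp (f : XR -> R[i]) : nat -> XR -> R^o := fun j =>
  if B j./2 is Some (y, s) then ball_component mu Phi y s (odd j) f else fun=> 0.
have comp_lin (c : R) f f' : comp (fun z => Complex c 0 * f z + f' z) =
    c *: comp f + comp f'.
  apply/funext => j; rewrite !fctE /comp; case: (B j./2) => [[y s]|].
    by rewrite ball_component_lin.
  by apply/funext => z; rewrite [RHS]/= [RHS](_ : _ = c * 0 + 0 :> R)// mulr0 addr0.
pose G : set ((nat -> XR -> R^o) * R) :=
  [set g | exists2 f, Tinf_v f & g = (comp f, complex.Re (l f))].
have GL g : G g -> forall j, L2 m (g.1 j).
  move=> [f Tf ->] j; rewrite /= /comp.
  case Bj : (B j./2) => [[y s]|]; last exact: L2_0.
  have [s0 _] := Bpos _ _ _ Bj.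
  by apply: L2Z; exact: (L2_part mu_borel mu_doubling hPhi y (odd j) (TvT _ Tf) s0).
have M0 : 0 <= 2 * K' * D by rewrite !mulr_ge0.
have [||g|g Gg e e0|g Gg K0 gK|h [Lh hM hG]] := @c0_L2_dual _ _ _ m _ G M0.
- exists (fun=> 0) => //; rewrite l0; congr (_, _).
  apply/funext => j; rewrite /comp; case: (B j./2) => [[y s]|]//.
  by rewrite ball_component0.
- move=> c g g' [f Tf ->] [f' Tf' ->] /=.
  exists (fun z => Complex c 0 * f z + f' z); first exact: Tv_lin.
  by rewrite comp_lin l_lin// ReD ReM /= mul0r subr0.
- exact: GL.
- have [f Tf ->] := Gg.
  have B0 j y s : B j = Some (y, s) -> 0 < s by move=> /Bpos[].
  have [n nP] := Tinf_v_tail mu_borel mu_doubling hPhi B0 Bfar Tf e0.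
  exists n.*2 => j nj; rewrite /= /comp.
  case Bj : (B j./2) => [[y s]|]; last by rewrite nrm0 ltW.
  apply: le_trans (nP _ _ _ _ Bj); last by rewrite -(doubleK n) half_leq.
  apply: nrm_ball_component => //; first exact: TvT.
  exact: B0 Bj.
- have [f Tf gf] := Gg; rewrite gf /= in gK *.
  have K00 : 0 <= K0 by apply: le_trans (gK 0%N); exact: nrm_ge0.
  apply: le_trans (ler_norm _) _; apply: le_trans (normr_Re_le _) _.
  apply: le_trans (l_le f Tf) _; rewrite mulrAC (mulrC _ D) ler_wpM2l//.
  have Tif := TvT _ Tf.
  rewrite -lee_fin -Tinf_normE//.
  apply: norm_le_Q => [|x r r0]; first by rewrite lee_fin !mulr_ge0.
  have [V0|V0] := eqVneq (V mu x r) 0.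
    by rewrite Q_V0// lee_fin !mulr_ge0.
  have Vp : 0 < V mu x r by rewrite lt_neqAle eq_sym V0 V_ge0.
  have [i [y [s [Bi xy Vys]]]] := Bcov x r r0 Vp.
  have [s0 _] := Bpos _ _ _ Bi.
  rewrite (QE Phi (Tinf_sqint mu_borel mu_doubling hPhi x Tif r0)) lee_fin.
  apply: le_trans (qK f x r y s Tif r0 s0 Vp xy Vys) _.
  rewrite (mulrC 2) -mulrA ler_wpM2l//.
  apply: le_trans (Qr_le_components mu_borel mu_doubling hPhi y Tif s0) _.
  have := gK i.*2; have := gK i.*2.+1.
  rewrite /comp /= uphalf_double doubleK Bi odd_double /=; lra.
have hpos j : 0 <= nrm m (h j) by exact: nrm_ge0.
pose lam j : R[i] := Complex (nrm m (h j)) 0.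
(* If |h_j| = 0, the amplitude is 0 by convention and the atom is zero. *)
pose aj j : XR -> R[i] := if B j./2 is Some (y, s)
  then pre_atom y s (odd j) (ball_weight mu Phi y s / nrm m (h j)) (h j) else fun=> 0.
have normc_lam j : normc (lam j) = nrm m (h j).
  by rewrite /lam /= expr0n/= addr0 sqrtr_sqr ger0_norm.
exists lam, aj; split.
- move=> j; rewrite /aj; case Bj : (B j./2) => [[y s]|]; last first.
    split; first exact: cmeasurable0.
    (* Zero is an atom on any ball; the unit ball about x0 serves for indices without a ball. *)
    exists x0, 1; split=> // [z [_ /=]|]; first by rewrite eqxx.
    by rewrite sqint0 lee_fin -(sqr_ball_weight mu Phi x0 1) sqr_ge0.
  have [s0 _] := Bpos _ _ _ Bj.
  split; first exact: (cmeasurable_pre_atom mu_borel y s _ _ (Lh j)).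
  exists y, s; split=> // [z [_]|].
    by rewrite /pre_atom; case: ifPn => [|_]; [rewrite inE|rewrite eqxx].
  apply: le_trans (sqint_pre_atom mu_borel y s _ _ (Lh j)) _.
  rewrite -sqr_ball_weight lee_fin -exprMn.
  have [->|h0] := eqVneq (nrm m (h j)) 0; first by rewrite mulr0 expr0n/= sqr_ge0.
  by rewrite divfK.
- move=> n; under eq_bigr do rewrite normc_lam.
  apply: le_trans (hM n) _; rewrite ler_wpM2r// lerDl//.
- move=> f Tf; have Gf : G (comp f, complex.Re (l f)) by exists f.
  rewrite (_ : (fun n => _) = fun n => \sum_(j < n) inner m (comp f j) (h j)).
    exact: hG _ Gf.
  apply/funext => n.
  apply: eq_bigr => j _; rewrite ReM [complex.Re (lam j)]/= [complex.Im (lam j)]/= mul0r subr0 /comp /aj.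
  case Bj : (B j./2) => [[y s]|]; last first.
    rewrite inner0l; have [h0|h0] := eqVneq (nrm m (h j)) 0; first by rewrite h0 mul0r.
    rewrite /pairing /= (_ : Rintegral _ _ _ = 0) ?mulr0//.
    rewrite [LHS](@eq_Rintegral _ _ _ _ _ (fun=> 0)); last first.
      by move=> z _; rewrite mulr0 /= mul0r.
    by rewrite Rintegral_cst ?mul0r//; exact: upper_measurable.
  have [s0 _] := Bpos _ _ _ Bj; have Tif := TvT _ Tf.
  rewrite (Re_pairing_pre_atom mu_borel mu_doubling hPhi y s0 _ _ (Lh j) Tif).
  have Lp := L2_part mu_borel mu_doubling hPhi y (odd j) Tif s0.
  rewrite /ball_component innerZl//.
  have [h0|h0] := eqVneq (nrm m (h j)) 0.
    rewrite h0 mul0r; have := normr_inner_le Lp (Lh j); rewrite h0 mulr0 normr_le0.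
    by move=> /eqP->; rewrite mulr0.
  by rewrite mulrA mulrCA mulfV// mulr1.
Qed.

End Dual.

(* For g in Ttilde, the integral of f g against dmu dt / t is by definition the
   value g f of the functional g at f. *)
Theorem theorem4p1 (d : measure_display) (R : realType)
    (X : measurableMetricType d R) (mu : {measure set X -> \bar R})
    (x0 : X) (Phi : R -> R) :
  borel_regular mu -> doubling mu -> orlicz_assumption Phi ->
  (exists2 C : R, 0 < C &
    forall g : (X * measurableTypeR R -> R[i]) -> R[i], Ttilde mu Phi g ->
    forall l : (X * measurableTypeR R -> R[i]) -> R[i],
      (forall f, Tinf_v mu Phi x0 f -> l f = g f) ->
      in_dual (Tinf_v mu Phi x0) (Tinf_norm mu Phi) l /\
      (dual_norm (Tinf_v mu Phi x0) (Tinf_norm mu Phi) l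
         <= C%:E * Ttilde_norm mu Phi g)%E) /\
  (exists2 C : R, 0 < C &
    forall l : (X * measurableTypeR R -> R[i]) -> R[i],
      in_dual (Tinf_v mu Phi x0) (Tinf_norm mu Phi) l ->
      exists g : (X * measurableTypeR R -> R[i]) -> R[i],
        [/\ Ttilde mu Phi g,
            forall f, Tinf_v mu Phi x0 f -> l f = g f &
            (Ttilde_norm mu Phi g
               <= C%:E * dual_norm (Tinf_v mu Phi x0) (Tinf_norm mu Phi) l)%E]).
Proof.
move=> mu_borel mu_doubling hPhi.
have TvT := @Tinf_v_Tinf _ _ _ mu Phi x0.
have Tv_lin := Tinf_v_lin mu_borel mu_doubling hPhi (x0 := x0).
split.
  exists 4 => // g [[g_lin _] [lam0 [aj0 dec0]]] l lg.
  (* Stated for every decomposition, because the norm of g is an infimum over them. *)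
  have bound lam aj : atomic_decomposition mu Phi g lam aj ->
      (dual_norm (Tinf_v mu Phi x0) (Tinf_norm mu Phi) l <=
       4%:E * \sum_(0 <= j <oo) (ComplexField.Normc.normc (lam j))%:E)%E.
    move=> dec; have [aj_atom lam_fin _] := dec.
    apply: (dual_norm_le TvT) => f Tf Nf; rewrite lg//.
    rewrite -[X in (4%:E * X)%E]fineK; last first.
      by rewrite ge0_fin_numE// nneseries_ge0// => j _ _; rewrite lee_fin normc_ge0.
    rewrite -EFinM lee_fin.
    exact: (atomic_decomposition_le mu_borel mu_doubling hPhi aj_atom lam_fin dec (TvT _ Tf)).
  split.
    split; first by move=> c f h Tf Th; rewrite !lg//; [exact: g_lin (TvT _ Tf) (TvT _ Th)|exact: Tv_lin].
    have [_ lam_fin _] := dec0; apply: le_lt_trans (bound _ _ dec0) _.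
    by rewrite lte_mul_pinfty.
  rewrite -lee_pdivrMl//; apply: le_ereal_inf_tmp => _ [lam [aj [dec ->]]].
  by rewrite lee_pdivrMl//; exact: bound dec.
have [C C0 series] := Tinf_v_dual_series mu_borel mu_doubling hPhi x0.
exists C => // l l_dual; have [l_lin l_fin] := l_dual.
have [lam [aj [aj_atom lam_le l_cvg]]] := series l l_dual.
have D_fin : dual_norm (Tinf_v mu Phi x0) (Tinf_norm mu Phi) l \is a fin_num.
  by rewrite ge0_fin_numE// (dual_norm_ge0 TvT)//; exact: Tinf_v0.
have lam_le_oo : (\sum_(0 <= j <oo) (ComplexField.Normc.normc (lam j))%:E <=
    C%:E * dual_norm (Tinf_v mu Phi x0) (Tinf_norm mu Phi) l)%E.
  apply: lime_le; first by apply: is_cvg_nneseries => j _ _; rewrite lee_fin normc_ge0.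
  by apply: nearW => n; rewrite big_mkord sumEFin -(fineK D_fin) -EFinM lee_fin.
have lam_fin : (\sum_(0 <= j <oo) (ComplexField.Normc.normc (lam j))%:E < +oo)%E.
  by apply: le_lt_trans lam_le_oo _; rewrite -(fineK D_fin) -EFinM ltry.
have Re_l f : Tinf_v mu Phi x0 f ->
    complex.Re (l f) = complex.Re (atomic_functional mu lam aj f).
  move=> Tf; apply: (cvg_unique _ (l_cvg f Tf)) => //.
  have [+ _] := atomic_functional_cvg mu_borel mu_doubling hPhi aj_atom lam_fin (TvT _ Tf).
  rewrite (_ : (fun n => complex.Re _) =
    fun n => \sum_(j < n) complex.Re (lam j * pairing mu f (aj j)))//.
  by apply/funext => n; exact: (Re_sum n (fun j => lam j * pairing mu f (aj j))).
exists (atomic_functional mu lam aj); split.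
- exact: (atomic_functional_Ttilde mu_borel mu_doubling hPhi aj_atom lam_fin).
- move=> f Tf; apply: eq_complexP; first exact: Re_l.
  (* The identity of real parts at i f + 0 is the identity of imaginary parts at f, since Re (i w) =
     - Im w. *)
  have Tv0 := Tinf_v0 mu Phi x0; have Tif := Tv_lin (Complex 0 1) _ _ Tf Tv0.
  have := Re_l _ Tif; rewrite l_lin//.
  have g_lin := atomic_functional_linear mu_borel mu_doubling hPhi aj_atom lam_fin.
  rewrite (g_lin (Complex 0 1) _ _ (TvT _ Tf) (TvT _ Tv0)) !ReD !ReM /=.
  by rewrite !mul0r !mul1r !sub0r (Re_l _ Tv0) => /addIr/oppr_inj.
- apply: le_trans lam_le_oo; apply: ereal_inf_lbound; exists lam, aj; split => //.
  exact: (atomic_functional_decomposition mu_borel mu_doubling hPhi aj_atom lam_fin).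
Qed.
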